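(* For each $n\ge 1$, let $\tau_n$ be a uniformly distributed random plane binary tree of size $n$ and let $\nu_{\tau_n}$ be its leaf-growth measure. Let $\mathsf c(x)=x^2(3-2x)$ for $x\in[0,1]$. Given $\alpha\in\mathbb{R}$, let $\beta(\alpha)$ be the unique value of $\beta\in\mathbb R$ for which the integral $$I(\alpha,\beta)=\int_0^1 \frac{1}{\sqrt{x^3(1-x)^3}}\left(\mathsf c(x)^{\alpha+1} x^{-\beta}+\mathsf c(1-x)^{\alpha+1} (1-x)^{-\beta}-1\right)\mathrm{d}x$$ is zero. Then, for every $\alpha\in\mathbb R$, as $n\to\infty$, $$\mathbb{E}\left[\sum_{l \text{ leaf of } \tau_n} \nu_{\tau_n}(l)^{\alpha+1}\right] = n^{-\beta(\alpha) + o(1)}.$$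
   Context: A (plane) binary tree is a finite rooted plane tree in which every vertex has either $2$ children (internal vertex) or $0$ children (leaf). Its size is its number of internal vertices; a tree of size $n$ has $n+1$ leaves. $\tau_n$ is uniform on the finite set of binary trees of size $n$. For integers $a,b\ge 0$ set $$C(a,b)=\frac{(a+1)(2a+1)(a+3b+3)}{(a+b+1)(a+b+2)(2(a+b)+3)}.$$ One has $C(a,b)+C(b,a)=1$. The leaf-growth measure $\nu_t$ of a binary tree $t$ is the probability measure on the leaves of $t$ defined recursively as follows: if $t$ has size $0$, $\nu_t$ is the Dirac mass at the only vertex; otherwise, if $t^L$, $t^R$ are the left and right subtrees of the root, of sizes $|t^L|,|t^R|$, then for every leaf $l$ of $t$, $$\nu_t(l)=\mathbf 1_{l\in t^L}\,C(|t^L|,|t^R|)\,\nu_{t^L}(l)+\mathbf 1_{l\in t^R}\,C(|t^R|,|t^L|)\,\nu_{t^R}(l).$$ *)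

(* Defs.v *)
From HB Require Import structures.
From mathcomp Require Import all_boot all_order all_algebra.
From mathcomp Require Import zify.
From mathcomp Require Import all_classical all_reals all_analysis.
Import Order.TTheory GRing.Theory Num.Theory.
Import numFieldNormedType.Exports.

Set Implicit Arguments.
Unset Strict Implicit.
Unset Printing Implicit Defensive.

Local Open Scope classical_set_scope.
Local Open Scope ring_scope.

Inductive bintree : Type := Leaf | Node of bintree & bintree.

Fixpoint bintree_encode (t : bintree) : GenTree.tree unit :=
  match t with
  | Leaf => GenTree.Leaf tt
  | Node l r => GenTree.Node 0 [:: bintree_encode l; bintree_encode r]
  end.

Fixpoint bintree_decode (t : GenTree.tree unit) : option bintree :=
  match t with
  | GenTree.Leaf _ => Some Leaf
  | GenTree.Node _ [:: l; r] =>
      if bintree_decode l is Some l' then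
        if bintree_decode r is Some r' then Some (Node l' r') else None
      else None
  | _ => None
  end.

Lemma bintree_encodeK : pcancel bintree_encode bintree_decode.
Proof. by elim=> [|l IHl r IHr] //=; rewrite IHl IHr. Qed.

HB.instance Definition _ := Countable.copy bintree (pcan_type bintree_encodeK).

(* Number of internal vertices. *)
Fixpoint tsize (t : bintree) : nat :=
  match t with
  | Leaf => 0
  | Node l r => (tsize l + tsize r).+1
  end.

Record btree (n : nat) := BTree { btree_val :> bintree; _ : tsize btree_val == n }.

HB.instance Definition _ n := [isSub for @btree_val n].
HB.instance Definition _ n := [Countable of btree n by <:].

(* All trees of height at most h; this includes all trees of size at most h. *)
Fixpoint trees_height (h : nat) : seq bintree :=
  if h is h'.+1 then
    Leaf :: [seq Node l r | l <- trees_height h', r <- trees_height h']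
  else [:: Leaf].

Lemma trees_height_uniq h : uniq (trees_height h).
Proof.
elim: h => //= h IH; apply/andP; split; first by apply/negP => /allpairsP[[l r] []].
by apply: allpairs_uniq => // -[l r] [l' r'] _ _ /= [-> ->].
Qed.

Lemma mem_trees_height h t : (tsize t <= h)%N -> t \in trees_height h.
Proof.
elim: h t => [|h IH] [|l r] //=; rewrite ltnS => le_h.
rewrite inE /=; apply/allpairsP; exists (l, r); split=> //=; apply: IH.
  exact: leq_trans (leq_addr _ _) le_h.
exact: leq_trans (leq_addl _ _) le_h.
Qed.

Definition btree_enum n : seq (btree n) := pmap insub (trees_height n).

Lemma btree_enumP n : Finite.axiom (btree_enum n).
Proof.
apply: Finite.uniq_enumP; first exact/pmap_sub_uniq/trees_height_uniq.
move=> t; rewrite mem_pmap_sub mem_trees_height //.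
by case: t => t /= /eqP ->.
Qed.

HB.instance Definition _ n := fintype.isFinite.Build (btree n) (@btree_enumP n).

Fixpoint leaf (t : bintree) : finType :=
  match t with
  | Leaf => unit
  | Node l r => (leaf l + leaf r)%type
  end.

Definition growthC (R : realType) (a b : nat) : R :=
  ((a + 1) * (2 * a + 1) * (a + 3 * b + 3))%N%:R /
  ((a + b + 1) * (a + b + 2) * (2 * (a + b) + 3))%N%:R.

Lemma growthC_gt0 (R : realType) a b : 0 < growthC R a b.
Proof. by rewrite divr_gt0 // ltr0n !muln_gt0 !addnS !addn0. Qed.

Lemma growthC_sum (R : realType) a b : growthC R a b + growthC R b a = 1.
Proof.
rewrite /growthC [(b + a)%N]addnC -mulrDl -natrD.
have den_neq0 : ((a + b + 1) * (a + b + 2) * (2 * (a + b) + 3))%N%:R != 0 :> R.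
  by rewrite pnatr_eq0 -lt0n !muln_gt0 !addnS !addn0.
apply: (canLR (mulfK den_neq0)); rewrite mul1r; congr (_%:R); nia.
Qed.

(* [leaf_growth R t l] is the mass that the measure gives to the leaf [l]. *)
Fixpoint leaf_growth (R : realType) (t : bintree) : leaf t -> R :=
  match t return leaf t -> R with
  | Leaf => fun=> 1
  | Node tL tR => fun l =>
      match l with
      | inl l' => growthC R (tsize tL) (tsize tR) * leaf_growth R l'
      | inr l' => growthC R (tsize tR) (tsize tL) * leaf_growth R l'
      end
  end.

Lemma leaf_growth_gt0 (R : realType) t (l : leaf t) : 0 < leaf_growth R l.
Proof.
elim: t l => [|tL IHL tR IHR] //= [l|l]; exact: mulr_gt0 (growthC_gt0 _ _ _) _.
Qed.

Lemma leaf_growth_sum (R : realType) t : \sum_(l : leaf t) leaf_growth R l = 1.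
Proof.
elim: t => [|tL IHL tR IHR].
  by rewrite big_const card_unit /= addr0.
by rewrite big_sumType /= -!mulr_sumr IHL IHR !mulr1 growthC_sum.
Qed.

Lemma card_leaf t : #|leaf t| = (tsize t).+1.
Proof.
elim: t => [|tL IHL tR IHR] /=; first exact: card_unit.
by rewrite card_sum IHL IHR addSn addnS.
Qed.

Definition uniform_btree (d : measure_display) (Omega : measurableType d)
    (R : realType) (P : probability Omega R) (n : nat) (X : Omega -> btree n) :=
  forall t : btree n, measurable (X @^-1` [set t]) /\
    P (X @^-1` [set t]) = (#|{: btree n}|%:R^-1)%:E.

Definition leaf_power_sum (R : realType) (alpha : R) (t : bintree) : R :=
  \sum_(l : leaf t) leaf_growth R l `^ (alpha + 1).

Definition cfun (R : realType) (x : R) : R := x ^+ 2 * (3 - 2 * x).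

(* The integral is extended-real valued and [+oo - +oo = -oo], so that
   [Iint alpha beta = 0] forces the integrand to be integrable. *)
Definition Iint (R : realType) (alpha beta : R) : \bar R :=
  (\int[lebesgue_measure]_(x in `]0%R, 1%R[)
     (1 / Num.sqrt (x ^+ 3 * (1 - x) ^+ 3) *
       (cfun x `^ (alpha + 1) * x `^ (- beta)
        + cfun (1 - x) `^ (alpha + 1) * (1 - x) `^ (- beta) - 1))%:E)%E.

(* Main.v *)
(* The sequence S_n = E[sum of nu^(alpha+1)] satisfies, after splitting at the
   root, Cat_(n+1) S_(n+1) = sum over a + b = n of
   Cat_a Cat_b (C(a,b)^(alpha+1) S_a + C(b,a)^(alpha+1) S_b), with Cat_n the Catalan
   numbers; call T the positive linear operator on the right.  By positivity
   and induction, S is bounded up to a constant by any f with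
   T f <= Cat_(n+1) f(n+1) for large n, and likewise from below.  For
   f n = (n+1)^(-g) one finds that T f - Cat_(n+1) f(n+1) is a positive factor
   times a Riemann sum which, by dominated convergence, tends to a positive
   multiple of I(alpha, g).  As I(alpha, .) is strictly increasing where it is
   finite, i.e. on g < 2 alpha + 3/2, the powers n^(-g) with g < beta(alpha) are
   eventually supersolutions, and those with beta(alpha) < g < 2 alpha + 3/2
   eventually subsolutions, which pins the exponent of S. *)
Require Import Defs.
From mathcomp Require Import all_boot all_order all_algebra.
From mathcomp Require Import ring lra zify.
From mathcomp Require Import all_classical all_reals all_analysis.
From mathcomp Require Import measurable_realfun.
Import Order.TTheory GRing.Theory Num.Theory.
Import numFieldNormedType.Exports.
Local Open Scope classical_set_scope.
Local Open Scope ring_scope.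
(* [tuple.tsize] shadows the size of trees. *)
Local Notation tsize := Defs.tsize.

Set Implicit Arguments.
Unset Strict Implicit.
Unset Printing Implicit Defensive.

(** * Sums over trees, split at the root *)

Lemma sum_btree_trees_height (V : nmodType) (F : bintree -> V) (n h : nat) :
  (n <= h)%N ->
  \sum_(t : btree n) F t = \sum_(t <- trees_height h | tsize t == n) F t.
Proof.
move=> nh; rewrite -[in RHS]big_filter.
rewrite (perm_big [seq btree_val t | t <- enum {: btree n}]) /=; last first.
  apply: uniq_perm.
  - exact: filter_uniq (trees_height_uniq h).
  - by rewrite map_inj_uniq ?enum_uniq //; exact: val_inj.
  move=> t; rewrite mem_filter; apply/andP/mapP => [[tn _]|[u _ ->]].
    by exists (BTree tn); rewrite ?mem_enum.
  case: u => u un /=; split => //.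
  by apply: mem_trees_height; rewrite (eqP un).
by rewrite big_map big_enum.
Qed.

Lemma sum_btreeS (V : nmodType) (F : bintree -> V) (n : nat) :
  \sum_(t : btree n.+1) F t =
  \sum_(a < n.+1) \sum_(l : btree a) \sum_(r : btree (n - a)) F (Node l r).
Proof.
rewrite (@sum_btree_trees_height _ _ _ n.+1) //= big_cons /= big_mkcond /=.
rewrite big_allpairs_dep /=.
(* Both subtrees can range over the one list [trees_height n], which contains every tree of size at
   most [n]. A left subtree of size above [n] gives an empty sum on either side. *)
transitivity (\sum_(l <- trees_height n) \sum_(a < n.+1 | tsize l == a)
    \sum_(r <- trees_height n | tsize r == (n - a)%N) F (Node l r)).
  apply: eq_bigr => l _; rewrite -big_mkcond /=; case: (ltnP (tsize l) n.+1) => ln.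
    rewrite (bigD1 (Ordinal ln)) //= [X in _ + X]big1 ?addr0; last first.
      by move=> i /andP[/eqP li /eqP]; case; exact/val_inj.
    apply: eq_bigl => r; rewrite eqSS; apply/eqP/eqP; lia.
  rewrite big_pred0 => [|r].
    rewrite big_pred0 // => a; apply/eqP => E.
    by move: (ltn_ord a); rewrite -E ltnNge ln.
  apply/eqP; lia.
rewrite (exchange_big_dep xpredT) //=; apply: eq_bigr => a _.
rewrite -(@sum_btree_trees_height _
  (fun l => \sum_(r <- trees_height n | tsize r == (n - a)%N) F (Node l r)) a n) //.
  apply: eq_bigr => l _.
  by rewrite (@sum_btree_trees_height _ (fun r => F (Node l r)) (n - a) n) // leq_subr.
by rewrite -ltnS ltn_ord.
Qed.

(** * Catalan numbers and their growth *)

Section Catalan.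
Variable R : realType.

Definition catalan (n : nat) : R := #|{: btree n}|%:R.

Lemma catalan0 : catalan 0 = 1.
Proof.
rewrite /catalan -sum1_card natr_sum.
by rewrite (sum_btree_trees_height (fun=> 1) (leqnn 0)) //= big_cons big_nil addr0.
Qed.

Lemma catalanS n : catalan n.+1 = \sum_(a < n.+1) catalan a * catalan (n - a).
Proof.
rewrite /catalan -sum1_card natr_sum (sum_btreeS (fun=> 1)).
by apply: eq_bigr => a _; rewrite !sumr_const -mulrnA -natrM mulnC.
Qed.

(** The binomial coefficient [2n] choose [n], given by the ratio of consecutive values so that
    [field] can compare neighbours. *)
Fixpoint central_binomial (n : nat) : R :=
  if n is m.+1 then central_binomial m * (2 * (2 * m%:R + 1) / (m%:R + 1))
  else 1.

Let gosper (m k : nat) : R := central_binomial k * central_binomial (m - k) *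
  (2 * k%:R - m%:R) / (2 * m%:R * (m%:R + 1)).

Let gosperB k j : gosper (k + j).+1 k.+1 - gosper (k + j).+1 k =
  central_binomial k / (k%:R + 1) * (central_binomial j / (j%:R + 1)).
Proof.
rewrite /gosper subSS addKn subSn ?leq_addr// addKn /= -!natr1 natrD.
have ? : 0 <= k%:R :> R by [].
have ? : 0 <= j%:R :> R by [].
field; do ?[apply/andP; split]; rewrite ?gt_eqF//; lra.
Qed.

(* Telescoping the convolution with Gosper's antidifference [gosper]. *)
Lemma catalanE n : catalan n = central_binomial n / (n%:R + 1).
Proof.
elim/ltn_ind: n => -[_|n IH]; first by rewrite catalan0 /= add0r divr1.
rewrite catalanS.
under eq_bigr => a _.
  have an : (a <= n)%N by rewrite -ltnS ltn_ord.
  rewrite IH// IH ?ltnS ?leq_subr// -gosperB subnKC//; over.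
rewrite -(big_mkord xpredT (fun a => gosper n.+1 a.+1 - gosper n.+1 a)).
rewrite telescope_sumr// /gosper subnn subn0 /= -!natr1.
have ? : 0 <= n%:R :> R by [].
field; do ?[apply/andP; split]; rewrite ?gt_eqF//; lra.
Qed.

Lemma catalan_gt0 n : 0 < catalan n.
Proof.
rewrite catalanE divr_gt0 ?ltr_wpDl//.
by elim: n => //= n IH; rewrite mulr_gt0// divr_gt0 ?mulr_gt0 ?ltr_wpDl ?mulr_ge0.
Qed.

Lemma catalan_rec n :
  catalan n.+1 * (n%:R + 2) = catalan n * (2 * (2 * n%:R + 1)).
Proof.
rewrite !catalanE /= -!natr1.
have ? : 0 <= n%:R :> R by [].
field; do ?[apply/andP; split]; rewrite ?gt_eqF//; lra.
Qed.

(* Comparable to [catalan n * n `^ (3 / 2) / 4 ^+ n].  The ratio of the squares of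
   consecutive values is rational in [n], so that monotonicity yields a positive
   limit without Stirling's formula. *)
Definition catalan_scaled n : R :=
  catalan n / 4 ^+ n * (n%:R + 1) * Num.sqrt (n%:R + 1).

Lemma catalan_scaled_gt0 n : 0 < catalan_scaled n.
Proof.
by rewrite !mulr_gt0 ?sqrtr_gt0 ?ltr_wpDl ?invr_gt0 ?exprn_gt0 ?catalan_gt0.
Qed.

(** After squaring, the claim becomes [(2n+1)^2 (n+2) <= 4 (n+1)^3], which holds coefficientwise. *)
Lemma catalan_scaled_nonincreasing : nonincreasing_seq catalan_scaled.
Proof.
apply/nonincreasing_seqP => n.
rewrite -ler_sqr ?nnegrE; [|exact/ltW/catalan_scaled_gt0..].
have n0 := ler0n R n.
rewrite /catalan_scaled !exprMn !sqr_sqrtr; [|by rewrite -?(natr1 n); lra..].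
have -> : catalan n.+1 = catalan n * (2 * (2 * n%:R + 1)) / (n%:R + 2).
  by rewrite -catalan_rec mulfK// gt_eqF//; lra.
have -> : (4 ^+ n.+1 : R)^-1 ^+ 2 = (4 ^+ n)^-1 ^+ 2 / 16.
  by rewrite (exprS 4 n) invfM exprMn; lra.
rewrite -(natr1 n).
set X : R := catalan n ^+ 2 * (4 ^+ n)^-1 ^+ 2.
have -> : (catalan n * (2 * (2 * n%:R + 1)) / (n%:R + 2)) ^+ 2 *
   ((4 ^+ n)^-1 ^+ 2 / 16) * (n%:R + 1 + 1) ^+ 2 * (n%:R + 1 + 1) =
   X * ((2 * n%:R + 1) ^+ 2 * (n%:R + 2) / 4).
  by rewrite /X; field; rewrite expf_neq0//= gt_eqF//; lra.
rewrite -[leRHS]mulrA ler_wpM2l//; first by rewrite mulr_ge0 ?sqr_ge0.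
lra.
Qed.

(** With [sqrt n] in place of [sqrt (n+1)] the sequence is nondecreasing from [n = 1], where its
    square is [1/4]. The squared ratio reduces this to [4 (m+1) (m+2) <= (2m+3)^2]. *)
Lemma catalan_scaled_ge n : 2^-1 <= catalan_scaled n.
Proof.
case: n => [|n].
  by rewrite /catalan_scaled catalan0 expr0 add0r sqrtr1; lra.
have step m : 4^-1 <= (catalan m.+1 / 4 ^+ m.+1 * (m.+1%:R + 1)) ^+ 2 * m.+1%:R.
  elim: m => [|m IH].
    have -> : catalan 1 = 1 by rewrite catalanE /=; field.
    by rewrite expr1; lra.
  apply: le_trans IH _.
  have -> : catalan m.+2 = catalan m.+1 * (2 * (2 * m.+1%:R + 1)) / (m.+1%:R + 2).
    by rewrite -catalan_rec mulfK// gt_eqF// addr_gt0.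
  rewrite (exprS 4 m.+1) -(natr1 m.+1) -!(natr1 m); set c := catalan _.
  have n0 := ler0n R m.
  have -> : (c * (2 * (2 * (m%:R + 1) + 1)) / (m%:R + 1 + 2) /
      (4 * 4 ^+ m.+1) * (m%:R + 1 + 1 + 1)) ^+ 2 * (m%:R + 1 + 1) =
      (c / 4 ^+ m.+1) ^+ 2 * ((2 * m%:R + 3) ^+ 2 * (m%:R + 2) / 4).
    by field; rewrite expf_neq0//= gt_eqF//; lra.
  rewrite exprMn -[leLHS]mulrA ler_wpM2l ?sqr_ge0//.
  nra.
rewrite -ler_sqr ?nnegrE; [|lra|exact/ltW/catalan_scaled_gt0].
rewrite /catalan_scaled exprMn sqr_sqrtr ?addr_ge0//.
apply: (@le_trans _ _ 4^-1); first by lra.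
by apply: le_trans (step n) _; rewrite ler_wpM2l ?sqr_ge0// lerDl.
Qed.

Lemma catalan_scaled_cvg :
  exists2 l : R, 0 < l & catalan_scaled n @[n --> \oo] --> l.
Proof.
have h : cvgn catalan_scaled.
  apply: nonincreasing_is_cvgn catalan_scaled_nonincreasing _.
  by exists 0 => _ [n _ <-]; exact/ltW/catalan_scaled_gt0.
exists (limn catalan_scaled) => //.
apply: (@lt_le_trans _ _ 2^-1) => //.
by apply: limr_ge => //; apply: nearW => n; exact: catalan_scaled_ge.
Qed.

Lemma catalan_scaled_le1 n : catalan_scaled n <= 1.
Proof.
suff <- : catalan_scaled 0 = 1 by exact: catalan_scaled_nonincreasing.
by rewrite /catalan_scaled catalan0 expr0 add0r sqrtr1 divr1 !mulr1.
Qed.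

End Catalan.

(** * The recurrence for the mean and the comparison principle *)

Section recurrence.
Variables (R : realType) (alpha : R).

Lemma leaf_power_sum_Node l r : leaf_power_sum alpha (Node l r) =
  growthC R (tsize l) (tsize r) `^ (alpha + 1) * leaf_power_sum alpha l +
  growthC R (tsize r) (tsize l) `^ (alpha + 1) * leaf_power_sum alpha r.
Proof.
rewrite /leaf_power_sum big_sumType /= !mulr_sumr.
by congr (_ + _); apply: eq_bigr => i _;
  rewrite powRM// ltW ?growthC_gt0 ?leaf_growth_gt0.
Qed.

Lemma leaf_power_sum_gt0 t : 0 < leaf_power_sum alpha t.
Proof.
elim: t => [|l IHl r IHr].
  rewrite /leaf_power_sum (eq_bigr (fun=> 1)) => [|i _]; last by rewrite /= powR1.
  by rewrite big_const card_unit /= addr0.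
by rewrite leaf_power_sum_Node addr_gt0// mulr_gt0// powR_gt0// growthC_gt0.
Qed.

Definition mean_power_sum (n : nat) : R :=
  (\sum_(t : btree n) leaf_power_sum alpha t) / catalan R n.

Lemma mean_power_sum_gt0 n : 0 < mean_power_sum n.
Proof.
rewrite divr_gt0 ?catalan_gt0//.
rewrite lt_neqAle sumr_ge0 ?andbT => [|t _]; last exact/ltW/leaf_power_sum_gt0.
apply/eqP => /esym/eqP; rewrite psumr_eq0 => [|t _]; last exact/ltW/leaf_power_sum_gt0.
move/allP => h; have := catalan_gt0 R n; rewrite /catalan ltr0n => /card_gt0P[t _].
by have := h t (mem_index_enum _); rewrite /= gt_eqF ?leaf_power_sum_gt0.
Qed.

Definition splitting_operator (f : nat -> R) (n : nat) : R :=
  \sum_(a < n.+1) catalan R a * catalan R (n - a) *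
    (growthC R a (n - a) `^ (alpha + 1) * f a +
     growthC R (n - a) a `^ (alpha + 1) * f (n - a)%N).

Lemma splitting_operator_mean_power_sum n :
  splitting_operator mean_power_sum n = catalan R n.+1 * mean_power_sum n.+1.
Proof.
rewrite /mean_power_sum [RHS]mulrC divfK ?gt_eqF ?catalan_gt0//.
rewrite (sum_btreeS (leaf_power_sum alpha)); apply: eq_bigr => a _.
under [RHS]eq_bigr => l _.
  under eq_bigr => r _.
    have -> : leaf_power_sum alpha (Node l r) =
      growthC R a (n - a) `^ (alpha + 1) * leaf_power_sum alpha l +
      growthC R (n - a) a `^ (alpha + 1) * leaf_power_sum alpha r.
      by rewrite leaf_power_sum_Node; case: l => l /= /eqP ->; case: r => r /= /eqP ->.
    over.
  rewrite big_split /= sumr_const -mulr_sumr; over.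
rewrite big_split /= sumr_const sumrMnl -mulr_sumr -[X in _ = X + _]mulr_natl.
rewrite -[X in _ = _ + X]mulr_natl -!/(catalan R _).
by field; rewrite !gt_eqF ?catalan_gt0.
Qed.

(** The operator has nonnegative coefficients and at [n] reads only values up to [n], so a bound
    [v <= K u] valid on an initial segment propagates by strong induction. The mean is an exact
    solution and can take either role. *)
Lemma splitting_comparison (u v : nat -> R) :
  (forall n, 0 < u n) -> (forall n, 0 < v n) ->
  (\forall n \near \oo, splitting_operator u n <= catalan R n.+1 * u n.+1) ->
  (\forall n \near \oo, catalan R n.+1 * v n.+1 <= splitting_operator v n) ->
  exists2 K : R, 0 < K & forall n, v n <= K * u n.
Proof.
move=> u0 v0 [n1 _ usup] [n2 _ vsub].
(* The sum dominates each ratio [v i / u i] below the point where both inequalities hold; the added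
   1 makes [K] positive. *)
pose m := maxn n1 n2; pose K := 1 + \sum_(i < m.+1) v i / u i.
have S0 : 0 <= \sum_(i < m.+1) v i / u i.
  by apply: sumr_ge0 => i _; exact/ltW/divr_gt0.
have K0 : 0 < K by rewrite ltr_pwDl.
exists K => // n; elim/ltn_ind: n => n IH.
have [nm|] := ltnP n m.+1.
  rewrite -ler_pdivrMr// /K (bigD1 (Ordinal nm)) //= addrCA lerDl.
  by rewrite addr_ge0// sumr_ge0// => i _; exact/ltW/divr_gt0.
case: n IH => // n IH; rewrite ltnS geq_max => /andP[n1n n2n].
rewrite -(ler_pM2l (catalan_gt0 R n.+1)) mulrCA.
apply: le_trans (vsub _ n2n) _.
apply: (@le_trans _ _ (K * splitting_operator u n)); last first.
  by rewrite ler_pM2l//; exact: usup.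
rewrite /splitting_operator mulr_sumr; apply: ler_sum => a _.
rewrite mulrCA ler_wpM2l ?mulr_ge0 ?(ltW (catalan_gt0 R _))//.
by rewrite mulrDr lerD// mulrCA ler_wpM2l ?powR_ge0// IH// ltnS ?leq_subr// -ltnS ltn_ord.
Qed.

End recurrence.

(** * The kernel of the integral *)

Section kernel.
Variable R : realType.
Implicit Types s g u x y k K : R.

Definition weight x : R := 1 / Num.sqrt (x ^+ 3 * (1 - x) ^+ 3).

(** Here [u] and [y] are independent: the integral has [u = cfun y], while the sums at finite [n]
    have [u = growthC R a b] and [y = (a+1)/(a+b+2)]. One estimate then serves both. *)
Definition bracket s g u y : R :=
  u `^ s * y `^ (- g) + (1 - u) `^ s * (1 - y) `^ (- g) - 1.

Lemma weight_sym x : weight (1 - x) = weight x.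
Proof. by rewrite /weight subKr [X in Num.sqrt X]mulrC. Qed.

Lemma bracket_sym s g u y : bracket s g (1 - u) (1 - y) = bracket s g u y.
Proof. by rewrite /bracket !subKr [X in X - 1]addrC. Qed.

Lemma weightE x : 0 < x < 1 -> weight x = x `^ (- (3 / 2)) * (1 - x) `^ (- (3 / 2)).
Proof.
move=> /andP[x0 x1].
have y0 : 0 <= 1 - x by lra.
rewrite /weight div1r -powR12_sqrt ?mulr_ge0 ?exprn_ge0 ?(ltW x0)//.
rewrite powRM ?exprn_ge0 ?(ltW x0)// -!powR_mulrn ?(ltW x0)// -!powRrM.
by rewrite invfM !powRN.
Qed.

Lemma weight_ge0 x : 0 <= weight x.
Proof. by rewrite /weight div1r invr_ge0 sqrtr_ge0. Qed.

Lemma weight_gt0 x : 0 < x < 1 -> 0 < weight x.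
Proof.
by move=> /andP[x0 x1]; rewrite /weight divr_gt0// sqrtr_gt0 mulr_gt0// exprn_gt0// subr_gt0.
Qed.

(** Shifting both sizes by one turns the factors [(k+1)^(3/2)] hidden in [catalan_scaled] into
    exactly [weight] at [(a+1)/(a+b+2)], up to a factor that depends on [a + b] alone. *)
Lemma catalanM a b : catalan R a * catalan R b =
  4 ^+ (a + b) / (a + b).+2%:R ^+ 3 *
  (catalan_scaled R a * catalan_scaled R b * weight (a.+1%:R / (a + b).+2%:R)).
Proof.
rewrite /catalan_scaled /weight !natr1.
have -> : (a + b).+2%:R = a.+1%:R + b.+1%:R :> R by rewrite -natrD addSn addnS.
have : 0 < b.+1%:R :> R by [].
have : 0 < a.+1%:R :> R by [].
move: (a.+1%:R : R) (b.+1%:R : R) => A B A0 B0.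
have rA := sqr_sqrtr (ltW A0); have rB := sqr_sqrtr (ltW B0).
have rA0 : 0 < Num.sqrt A by rewrite sqrtr_gt0.
have rB0 : 0 < Num.sqrt B by rewrite sqrtr_gt0.
have -> : (A / (A + B)) ^+ 3 * (1 - A / (A + B)) ^+ 3 =
    (A * B * Num.sqrt A * Num.sqrt B / (A + B) ^+ 3) ^+ 2.
  rewrite !exprMn rA rB; field; rewrite gt_eqF//; lra.
rewrite sqrtr_sqr ger0_norm; last first.
  by rewrite divr_ge0 ?exprn_ge0 ?mulr_ge0// ltW ?addr_gt0.
rewrite exprD.
by field; rewrite !expf_neq0//= !gt_eqF//; lra.
Qed.

Lemma growthCB a b : 1 - growthC R a b = growthC R b a.
Proof. by rewrite -(growthC_sum R a b) addrC addKr. Qed.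

(** Expanding [catalan R n.+1] by its convolution puts the subtracted term inside the sum, where it
    becomes the [- 1] of [bracket]; homogeneity of the power pulls out [f n.+1]. *)
Lemma splitting_operator_powR alpha g n : let f (k : nat) : R := k.+1%:R `^ (- g) in
  splitting_operator alpha f n - catalan R n.+1 * f n.+1 =
  4 ^+ n / n.+2%:R ^+ 3 * f n.+1 *
  \sum_(a < n.+1) catalan_scaled R a * catalan_scaled R (n - a) *
    (weight (a.+1%:R / n.+2%:R) *
     bracket (alpha + 1) g (growthC R a (n - a)) (a.+1%:R / n.+2%:R)).
Proof.
move=> f; rewrite /splitting_operator catalanS mulr_suml -sumrB mulr_sumr.
apply: eq_bigr => a _.
have an : (a <= n)%N by rewrite -ltnS ltn_ord.
rewrite catalanM subnKC// /bracket growthCB.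
have -> : 1 - a.+1%:R / n.+2%:R = (n - a).+1%:R / n.+2%:R :> R.
  rewrite -!natr1 natrB//.
  have n0 := ler0n R n.
  by field; rewrite gt_eqF//; lra.
have fE (k : nat) : k.+1%:R `^ (- g) = f n.+1 * (k.+1%:R / n.+2%:R) `^ (- g) :> R.
  by rewrite -powRM// mulrC divfK.
rewrite {1 2}/f !fE.
by rewrite -/(f n.+1); ring.
Qed.

Lemma expR_sub1_le (z : R) : `|expR z - 1| <= `|z| * expR `|z|.
Proof.
have [z0|z0] := ltrP z 0.
  rewrite (ltr0_norm z0) [in leLHS]ler0_norm ?subr_le0 ?expR_le1 ?(ltW z0)//.
  have h1 := expR_ge1Dx z; have h2 : 1 <= expR (- z) by rewrite -expR0 ler_expR; lra.
  nra.
rewrite (ger0_norm z0) [in leLHS]ger0_norm ?subr_ge0 -?expR0 ?ler_expR// expR0.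
have := expR_ge1Dx (- z); rewrite expRN => h.
have e0 := expR_gt0 z.
have : (1 - z) * expR z <= 1 by rewrite -ler_pdivlMr// div1r; lra.
lra.
Qed.

Lemma norm_ln_le x : 0 < x <= 1 -> `|ln x| <= (1 - x) / x.
Proof.
move=> /andP[x0 x1]; rewrite ler0_norm ?ln_le0// -lnV ?posrE//.
have e : x^-1 = 1 + (1 - x) / x by field; rewrite gt_eqF.
rewrite [X in ln X]e; apply: le_ln1Dx; apply: (@lt_le_trans _ _ 0) => //.
by rewrite divr_ge0 ?subr_ge0// ltW.
Qed.

(** Adding the two endpoint values covers both signs of [s], hence both monotonicities, with one
    constant. *)
Lemma powR_le_sum s k K x : 0 < k -> k <= x <= K -> x `^ s <= k `^ s + K `^ s.
Proof.
move=> k0 /andP[kx xK]; have x0 := lt_le_trans k0 kx; have K0 := lt_le_trans x0 xK.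
have [s0|s0] := lerP 0 s.
  by rewrite -[leLHS]add0r lerD ?powR_ge0// ge0_ler_powR// nnegrE ltW.
rewrite -[leLHS]addr0 lerD ?powR_ge0// -(opprK s) powRN [leRHS]powRN.
by rewrite lef_pV2 ?posrE ?powR_gt0// ge0_ler_powR ?nnegrE ?oppr_ge0 ?(ltW s0) ?(ltW k0) ?(ltW x0).
Qed.

(** The product of powers is the exponential of a combination of [ln (1 - u)] and [ln (1 - y)]. With
    [u = O(y^2)] and [1 - u] bounded below, both logarithms are [O(y)], so the [- 1] cancels the
    leading term. *)
Lemma bracket_far_bound s g k K : 0 < k -> exists2 M : R, 0 <= M &
  forall u y, 0 < y <= 2^-1 -> 0 < u <= K * y ^+ 2 -> k * (1 - y) ^+ 2 <= 1 - u ->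
  `|(1 - u) `^ s * (1 - y) `^ (- g) - 1| <= M * y.
Proof.
move=> k0; pose L := `|s| * (4 * `|K| / k) + 2 * `|g|.
have L0 : 0 <= L by rewrite addr_ge0 ?mulr_ge0// invr_ge0 ltW.
exists (L * expR L); first by rewrite mulr_ge0 ?expR_ge0.
move=> u y /andP[y0 y2] /andP[u0 uK] ku.
have v0 : k / 4 <= 1 - u by apply: le_trans ku; rewrite ler_pM2l// ; nra.
have v00 : 0 < 1 - u by apply: lt_le_trans v0; rewrite divr_gt0.
have lnv : `|ln (1 - u)| <= 4 * `|K| / k * y.
  apply: le_trans (norm_ln_le _) _; first by rewrite v00 lerBlDr lerDl ltW.
  rewrite subKr ler_pdivrMr//.
  have -> : 4 * `|K| / k * y * (1 - u) = (`|K| * y) * ((1 - u) / (k / 4)).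
    by field; rewrite gt_eqF.
  apply: (@le_trans _ _ (`|K| * y)).
    apply: le_trans uK _; apply: (@le_trans _ _ (`|K| * y ^+ 2)).
      by rewrite ler_wpM2r ?sqr_ge0// ler_norm.
    by rewrite ler_wpM2l//; nra.
  by rewrite ler_peMr ?mulr_ge0 ?(ltW y0)// ler_pdivlMr ?mul1r// divr_gt0.
have lnw : `|ln (1 - y)| <= 2 * y.
  apply: le_trans (norm_ln_le _) _; first by apply/andP; split; lra.
  rewrite subKr ler_pdivrMr; last lra.
  nra.
have -> : (1 - u) `^ s * (1 - y) `^ (- g) = expR (s * ln (1 - u) - g * ln (1 - y)).
  by rewrite /powR !gt_eqF//; [rewrite -expRD mulNr|lra].
have zL : `|s * ln (1 - u) - g * ln (1 - y)| <= L * y.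
  apply: le_trans (ler_normB _ _) _; rewrite !normrM /L mulrDl.
  rewrite lerD//; first by rewrite -mulrA ler_wpM2l.
  by rewrite [X in _ <= X * _]mulrC -mulrA ler_wpM2l.
apply: le_trans (expR_sub1_le _) _.
rewrite mulrAC ler_pM ?expR_ge0// ler_expR; apply: le_trans zL _.
by rewrite ler_piMr//; lra.
Qed.

Lemma weight_near_le y : 0 < y <= 2^-1 ->
  weight y <= y `^ (- (3 / 2)) * (2^-1) `^ (- (3 / 2)).
Proof.
move=> /andP[y0 y2]; rewrite weightE; last by apply/andP; split; lra.
rewrite ler_wpM2l ?powR_ge0// !powRN lef_pV2 ?posrE ?powR_gt0//; [|lra].
by rewrite ge0_ler_powR ?nnegrE//; lra.
Qed.

Lemma bracket_near_bound s g k K : 0 < k -> g < 2 * s - 2^-1 ->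
  exists2 r : R, 0 < r < 1 & exists2 M : R, 0 <= M &
  forall u y, 0 < y <= 2^-1 -> k * y ^+ 2 <= u <= K * y ^+ 2 ->
    k * (1 - y) ^+ 2 <= 1 - u ->
  `|weight y * bracket s g u y| <= M * y `^ (- r).
Proof.
move=> k0 gs; have [M M0 far] := bracket_far_bound s g K k0.
(* The two singular exponents: [1/2] is [3/2 - 1], from the [O(y)] part against the weight, and the
   other comes from the term in [u]. The second is below 1 exactly when [g < 2 s - 1/2]. *)
pose r := Num.max (2^-1) (g - 2 * s + 3 / 2).
exists r; first by rewrite /r lt_max gt_max; apply/and3P; split; lra.
pose T := k `^ s + K `^ s; pose W := (2^-1 : R) `^ (- (3 / 2)).
have T0 : 0 <= T by rewrite addr_ge0 ?powR_ge0.
have W0 : 0 <= W by rewrite powR_ge0.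
exists (W * (T + M)); first by rewrite mulr_ge0// addr_ge0.
move=> u y y02 /andP[ku uK] kv; have /andP[y0 y2] := y02.
have ysq0 : 0 < y ^+ 2 by rewrite exprn_gt0.
have u0 : 0 < u by apply: lt_le_trans ku; rewrite mulr_gt0.
have near : u `^ s * y `^ (- g) <= T * y `^ (2 * s - g).
  have -> : u `^ s = (u / y ^+ 2) `^ s * y `^ (2 * s).
    by rewrite powRrM powR_mulrn ?(ltW y0)// -powRM ?divfK ?divr_ge0 ?gt_eqF// ltW.
  have -> : y `^ (2 * s - g) = y `^ (2 * s) * y `^ (- g).
    by rewrite powRD// (gt_eqF y0) implybT.
  rewrite mulrA ler_wpM2r ?powR_ge0// ler_wpM2r ?powR_ge0//.
  by apply: powR_le_sum => //; rewrite ler_pdivlMr// ler_pdivrMr// ku uK.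
rewrite normrM ger0_norm ?weight_ge0//.
have powy a : - r <= a -> y `^ a <= y `^ (- r).
  by move=> ra; apply: ger_powR => //; apply/andP; split=> //; lra.
apply: (@le_trans _ _ ((y `^ (- (3 / 2)) * W) * (T * y `^ (2 * s - g) + M * y))).
  apply: ler_pM => //; first exact: weight_ge0.
    exact: weight_near_le.
  rewrite /bracket -addrA; apply: le_trans (ler_normD _ _) _.
  rewrite lerD//; first by rewrite ger0_norm// mulr_ge0 ?powR_ge0.
  by apply: far => //; rewrite u0.
have -> : y `^ (- (3 / 2)) * W * (T * y `^ (2 * s - g) + M * y) =
   W * (T * (y `^ (- (3 / 2)) * y `^ (2 * s - g)) + M * (y `^ (- (3 / 2)) * y `^ 1)).
  by rewrite powRr1 ?(ltW y0)//; ring.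
rewrite -mulrA ler_wpM2l// [leRHS]mulrDl -!powRD; [|by apply/implyP => _; rewrite gt_eqF..].
have r1 : 2^-1 <= r by rewrite /r le_max lexx.
have r2 : g - 2 * s + 3 / 2 <= r by rewrite /r le_max lexx orbT.
by rewrite lerD// ler_wpM2l// powy//; lra.
Qed.

(* The near endpoint contributes [y `^ (2 s - g - 3/2)], which is why [g] must
   stay below [2 s - 1/2]; the far endpoint always contributes [y `^ (- 1/2)]. *)
Lemma weight_bracket_bound s g k K : 0 < k -> g < 2 * s - 2^-1 ->
  exists2 r : R, 0 < r < 1 & exists2 M : R, 0 <= M &
  forall u y, 0 < y < 1 -> k * y ^+ 2 <= u <= K * y ^+ 2 ->
    k * (1 - y) ^+ 2 <= 1 - u <= K * (1 - y) ^+ 2 ->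
  `|weight y * bracket s g u y| <= M * (y `^ (- r) + (1 - y) `^ (- r)).
Proof.
move=> k0 gs; have [r r1 [M M0 near]] := bracket_near_bound K k0 gs.
exists r => //; exists M => // u y /andP[y0 y1] hu hv.
have [y2|y2] := lerP y 2^-1.
  apply: le_trans (near u y _ hu _) _; rewrite ?y0//; first by case/andP: hv.
  by rewrite ler_wpM2l// lerDl powR_ge0.
rewrite -weight_sym -bracket_sym.
apply: le_trans (near (1 - u) (1 - y) _ hv _) _.
- by apply/andP; split; lra.
- by rewrite !subKr; case/andP: hu.
- by rewrite ler_wpM2l// lerDr powR_ge0.
Qed.

End kernel.

(** * Riemann sums *)

Section riemann_sum.
Variable R : realType.
Implicit Types x : R.
Notation mu := (@lebesgue_measure R).

(** As a rational function of the sample point [y] and of [e = 1/(a+b+2)], this tends to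
    [y^2 (3 - 2 y) = cfun y] when [e] tends to 0. *)
Lemma growthC_ratio a b (e := (a + b).+2%:R^-1 : R) (y := a.+1%:R * e) :
  growthC R a b = y * (2 * y - e) * (3 - 2 * y - e) / ((1 - e) * (2 - e)).
Proof.
rewrite /y /e /growthC !(natrM, natrD) -!natr1 !natrD.
have a0 := ler0n R a; have b0 := ler0n R b.
by field; do ?[apply/andP; split]; rewrite ?gt_eqF//; lra.
Qed.

(** Quadratic bounds uniform in the sizes, as the kernel estimate requires; they follow from
    [e <= y], [y + e <= 1] and [e <= 1/2]. *)
Lemma growthC_bound a b (y := a.+1%:R / (a + b).+2%:R : R) :
  2^-1 * y ^+ 2 <= growthC R a b <= 12 * y ^+ 2.
Proof.
pose e : R := (a + b).+2%:R^-1.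
have e0 : 0 < e by rewrite invr_gt0.
have e2 : e <= 2^-1 by rewrite lef_pV2 ?posrE// ler_nat.
have ye : e <= y by rewrite -[leLHS]mul1r ler_pM2r// ler1n.
have ye1 : y + e <= 1.
  by rewrite -[e]mul1r -mulrDl ler_pdivrMr// mul1r natr1 ler_nat !ltnS leq_addr.
have h : 0 < (1 - e) * (2 - e) by rewrite mulr_gt0//; lra.
rewrite growthC_ratio -/e -/(y) ler_pdivlMr// ler_pdivrMr//.
have l1 : 0 <= y * (2 * y - e) by rewrite mulr_ge0//; lra.
have y2 : 0 <= y ^+ 2 by rewrite sqr_ge0.
apply/andP; split.
  have : y ^+ 2 * 1 <= y * (2 * y - e) * (3 - 2 * y - e).
    by rewrite ler_pM//; [nra|lra].
  have : (1 - e) * (2 - e) <= 2 by nra.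
  nra.
have : y * (2 * y - e) * (3 - 2 * y - e) <= (2 * y ^+ 2) * 3.
  by rewrite ler_pM//; [lra|nra|lra].
have : 2^-1 <= (1 - e) * (2 - e) by nra.
nra.
Qed.

(* The index of the interval of length [n.+1%:R^-1] that contains [x]. *)
Definition cell n x : nat := Num.truncn (n.+1%:R * x : R).

Lemma cell_itv n x : 0 < x -> (cell n x)%:R <= n.+1%:R * x < (cell n x).+1%:R.
Proof. by move=> x0; apply: truncn_itv; rewrite mulr_ge0// ltW. Qed.

Lemma cell_le n x : 0 < x < 1 -> (cell n x <= n)%N.
Proof.
move=> /andP[x0 x1]; have /andP[h _] := cell_itv n x0.
by rewrite -ltnS -(ltr_nat R); apply: le_lt_trans h _; rewrite gtr_pMr.
Qed.

(** The sample point attached to the cell of [x]. The shift to [(a+1)/(n+2)] keeps it away from both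
    endpoints, where the weight is singular. *)
Definition cell_ratio n x : R := (cell n x).+1%:R / n.+2%:R.

Lemma cell_ratioB n x : 0 < x < 1 ->
  1 - cell_ratio n x = (n - cell n x).+1%:R / n.+2%:R.
Proof.
move=> x01; rewrite /cell_ratio -!natr1 natrB ?cell_le//.
by have n0 := ler0n R n; field; rewrite gt_eqF//; lra.
Qed.

Lemma cell_ratio_itv n x : 0 < x < 1 ->
  x * (1 - n.+2%:R^-1) <= cell_ratio n x <= x + (1 - x) / n.+2%:R.
Proof.
move=> /andP[x0 x1]; have /andP[h1 h2] := cell_itv n x0.
rewrite /cell_ratio ler_pdivlMr// ler_pdivrMr//.
have n0 := ler0n R n.
have -> : x * (1 - n.+2%:R^-1) * n.+2%:R = x * n.+1%:R.
  by rewrite -!natr1; field; rewrite gt_eqF//; lra.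
have -> : (x + (1 - x) / n.+2%:R) * n.+2%:R = x * n.+1%:R + 1.
  by rewrite -!natr1; field; rewrite gt_eqF//; lra.
by move: h1 h2; rewrite -(natr1 (cell n x)) [x * _]mulrC => h1 h2; apply/andP; split; lra.
Qed.

Lemma cvg_cell_ratio x : 0 < x < 1 -> cell_ratio n x @[n --> \oo] --> x.
Proof.
move=> x01.
have e0 : (n.+2%:R^-1 : R) @[n --> \oo] --> (0 : R).
  by have := @cvg_harmonic R; rewrite -cvg_shiftS.
apply: (@squeeze_cvgr _ _ _ _ (fun n => x * (1 - n.+2%:R^-1)) (fun n => x + (1 - x) * n.+2%:R^-1)).
- by apply: nearW => n; exact: cell_ratio_itv.
- have : x * (1 - n.+2%:R^-1) @[n --> \oo] --> x * (1 - 0).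
    by apply: cvgMl_tmp; apply: cvgB => //; exact: cvg_cst.
  by rewrite subr0 mulr1.
- have : x + (1 - x) * n.+2%:R^-1 @[n --> \oo] --> x + (1 - x) * 0.
    by apply: cvgD; [exact: cvg_cst|exact: cvgMl_tmp].
  by rewrite mulr0 addr0.
Qed.

Lemma cvg_cell x : 0 < x -> cell n x @[n --> \oo] --> \oo.
Proof.
move=> x0; apply/cvgnyPge => A.
have h : A%:R / x < (Num.bound (A%:R / x))%:R by rewrite archi_boundP// divr_ge0// ltW.
exists (Num.bound (A%:R / x)) => // n /= kn; rewrite -ltnS -(ltr_nat R).
have /andP[_ +] := cell_itv n x0; apply: le_lt_trans.
by rewrite -ler_pdivrMr// (le_trans (ltW h))// ler_nat leqW.
Qed.

Lemma cvg_sub_cell x : 0 < x < 1 -> (n - cell n x)%N @[n --> \oo] --> \oo.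
Proof.
move=> /andP[x0 x1]; apply/cvgnyPge => A.
have y0 : 0 < 1 - x by rewrite subr_gt0.
have h : A.+1%:R / (1 - x) < (Num.bound (A.+1%:R / (1 - x)))%:R.
  by rewrite archi_boundP// divr_ge0// ltW.
exists (Num.bound (A.+1%:R / (1 - x))) => // n /= kn.
have /andP[+ _] := cell_itv n x0.
have : A.+1%:R <= n.+1%:R * (1 - x).
  by rewrite -ler_pdivrMr// (le_trans (ltW h))// ler_nat leqW.
move=> h1 h2; rewrite -ltnS -(ltr_nat R) -(natr1 (n - _)%N) natrB; last first.
  by rewrite cell_le ?x0.
by move: h1 h2; rewrite -(natr1 n) -(natr1 A); lra.
Qed.

Lemma cvg_growthC_cell x : 0 < x < 1 ->
  growthC R (cell n x) (n - cell n x) @[n --> \oo] --> cfun x.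
Proof.
move=> x01; have y := cvg_cell_ratio x01.
have e0 : (n.+2%:R^-1 : R) @[n --> \oo] --> (0 : R).
  by have := @cvg_harmonic R; rewrite -cvg_shiftS.
under eq_cvg => n.
  rewrite growthC_ratio subnKC ?cell_le// -/(cell_ratio n x); over.
have -> : cfun x = x * (2 * x - 0) * (3 - 2 * x - 0) / ((1 - 0) * (2 - 0)).
  by rewrite /cfun; field.
have cst1 (c : R) : (fun=> c : R) @ \oo --> c by exact: cvg_cst.
have y2 : 2 * cell_ratio n x @[n --> \oo] --> 2 * x by exact: cvgMl_tmp.
apply: cvgM; first apply: cvgM; first apply: cvgM => //.
- exact: cvgB.
- by apply: cvgB => //; exact: cvgB.
- apply: cvgV; first by rewrite !subr0 mul1r.
  by apply: cvgM; apply: cvgB.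
Qed.

Definition step_fun (h : nat -> R) n x : R :=
  \sum_(a < n.+1) h a * \1_[set` `[a%:R / n.+1%:R, a.+1%:R / n.+1%:R[%R] x.

Lemma step_funE h n x : 0 < x < 1 -> step_fun h n x = h (cell n x).
Proof.
move=> x01; have /andP[x0 x1] := x01.
have kn : (cell n x < n.+1)%N by rewrite ltnS cell_le.
have inE' (a : nat) : (x \in [set` `[a%:R / n.+1%:R, a.+1%:R / n.+1%:R[%R]) = (a == cell n x).
  rewrite mem_setE in_itv /= ler_pdivrMr// ltr_pdivlMr// mulrC.
  apply/idP/eqP => [h'|->]; last exact: cell_itv.
  by apply/esym/eqP; rewrite /cell truncn_eq// mulr_ge0 // ltW.
rewrite /step_fun (bigD1 (Ordinal kn)) //= big1 ?addr0 => [|i ik].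
  by rewrite indicE inE' eqxx mulr1.
rewrite indicE inE' (_ : (_ == _) = false) ?mulr0//.
by apply: contra_neqF ik => /eqP e; exact: val_inj.
Qed.

Lemma measurable_step_fun h n : measurable_fun setT (step_fun h n).
Proof.
apply: measurable_sum => a; apply: measurable_funM => //.
Qed.

Lemma integral_step_fun h n :
  (\int[mu]_(x in `]0%R, 1%R[) (step_fun h n x)%:E)%E =
  (n.+1%:R^-1 * \sum_(a < n.+1) h a)%:E.
Proof.
(* The first cell contains 0, so the endpoint is added before the integral is split over the
   cells. *)
rewrite integral_itv_obnd_cbnd; last first.
  by apply/measurable_EFinP; exact: measurable_funTS (measurable_step_fun h n).
under eq_integral do rewrite /step_fun -sumEFin.
have i01 a : mu.-integrable `[0%R, 1%R[
    (EFin \o (\1_[set` `[a%:R / n.+1%:R, a.+1%:R / n.+1%:R[%R])).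
  by apply: (integrableS measurableT) => //; exact: integrable_indic_itv.
rewrite integral_sum //=; last first.
  move=> a; exact: (integrableZl _ (h a) (i01 a)).
rewrite mulr_sumr -sumEFin; apply: eq_bigr => a _.
under eq_integral do rewrite EFinM.
rewrite (integralZl _ (i01 a))//.
rewrite integral_indic// setIidl; last first.
  move=> x /=; rewrite !in_itv /= => /andP[h1 h2]; apply/andP; split.
    by apply: le_trans h1; rewrite divr_ge0.
  by apply: lt_le_trans h2 _; rewrite ler_pdivrMr// mul1r ler_nat.
rewrite /= lebesgue_measure_itv /= lte_fin ltr_pM2r// ltr_nat leqnn -EFinB -EFinM.
by congr EFin; rewrite -(natr1 a); field; rewrite ?nat1r ?natr1 ?pnatr_eq0.
Qed.

End riemann_sum.

(** * Integrability of powers on the unit interval *)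

Section convergence.
Variable R : realType.
Implicit Types x s g p e : R.
Notation mu := (@lebesgue_measure R).

Lemma continuous_powR p x : 0 < x -> {for x, continuous (fun y : R => y `^ p)}.
Proof.
move=> x0; apply: differentiable_continuous; apply/derivable1_diffP.
by have [] := is_derive1_powR p x0.
Qed.

Lemma cvg_powR (u : nat -> R) p x : 0 < x -> u n @[n --> \oo] --> x ->
  u n `^ p @[n --> \oo] --> x `^ p.
Proof. by move=> x0 ux; exact: (continuous_cvg _ (continuous_powR x0)). Qed.

Lemma measurable_powR_onem p : measurable_fun setT (fun x : R => (1 - x) `^ p).
Proof.
rewrite (_ : (fun x => _) = (@powR R ^~ p) \o (fun x => 1 - x))//.
apply: measurableT_comp; first exact: measurable_powR.
exact: measurable_funB.
Qed.

Lemma integral_powR_pos p e : 0 < p -> 0 < e < 1 ->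
  (\int[mu]_(x in `[e, 1%R]) (x `^ (p - 1))%:E = ((1 - e `^ p) / p)%:E)%E.
Proof.
move=> p0 /andP[e0 e1].
have d x : 0 < x -> is_derive x 1 (fun x : R => x `^ p / p) (x `^ (p - 1)).
  move=> x0; have h := is_derive1_powR p x0.
  have -> : x `^ (p - 1) = p^-1 *: (p * x `^ (p - 1)).
    by rewrite scalerA mulVf ?scale1r// gt_eqF.
  have -> : (fun x : R => x `^ p / p) = p^-1 \*: (fun x => x `^ p).
    by apply/funext => y /=; rewrite mulrC.
  exact: is_deriveZ.
have c x : 0 < x -> {for x, continuous (fun x : R => x `^ p / p)}.
  by move=> /d[dx _]; apply: differentiable_continuous; apply/derivable1_diffP.
rewrite (@continuous_FTC2 _ _ (fun x => x `^ p / p)) //.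
- by rewrite powR1 -EFinB -mulrBl.
- apply: derivable_within_continuous => x; rewrite in_itv /= => /andP[ex _].
  by have [] := is_derive1_powR (p - 1) (lt_le_trans e0 ex).
- split.
  + by move=> x; rewrite in_itv /= => /andP[ex _]; have [] := d x (lt_trans e0 ex).
  + by apply: cvg_at_right_filter; exact: c.
  + by apply: cvg_at_left_filter; exact: c.
- move=> x; rewrite in_itv /= => /andP[ex _].
  by have h := d x (lt_trans e0 ex); rewrite derive1E derive_val.
Qed.

Lemma integral_powR_onem_pos p e : 0 < p -> 0 < e < 1 ->
  (\int[mu]_(x in `[0%R, (1 - e)%R]) ((1 - x) `^ (p - 1))%:E = ((1 - e `^ p) / p)%:E)%E.
Proof.
move=> p0 e01; have /andP[e0 e1] := e01.
rewrite (@integration_by_substitution_onem _ (fun x => (1 - x) `^ (p - 1))).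
- rewrite /unstable.onem subKr.
  by under eq_integral do rewrite subKr; exact: integral_powR_pos.
- by apply/andP; split; lra.
- apply: continuous_in_subspaceT => x /set_mem /=; rewrite in_itv /= => /andP[_ ex].
  apply: (@continuous_comp _ _ _ (fun x => 1 - x) (@powR R ^~ (p - 1))).
    by apply: cvgB; [exact: cvg_cst|exact: cvg_id].
  by apply: continuous_powR; lra.
Qed.

(** Monotone convergence along the intervals [[1/(n+2), 1 - 1/(n+2)]], which exhaust []0, 1[]: a
    uniform bound on compact subintervals suffices. *)
Lemma integrable_oo01 (f : R -> R) (C : R) : measurable_fun setT f ->
  (forall x, 0 <= f x) ->
  (forall e, 0 < e <= 2^-1 -> (\int[mu]_(x in `[e, (1 - e)%R]) (f x)%:E <= C%:E)%E) ->
  mu.-integrable `]0%R, 1%R[ (EFin \o f).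
Proof.
move=> mf f0 fC; apply/integrableP; split.
  by apply/measurable_EFinP; exact: measurable_funTS.
under eq_integral do rewrite /= ger0_norm//.
pose F n : set R := [set` `[n.+2%:R^-1, 1 - n.+2%:R^-1]%R].
have FU : [set` `]0, 1[%R] = \bigcup_n F n :> set R.
  apply/seteqP; split=> x /=; rewrite in_itv /=.
    move=> /andP[x0 x1].
    pose m := maxn (Num.bound x^-1) (Num.bound (1 - x)^-1).
    have mx : x^-1 < m.+2%:R.
      apply: lt_le_trans (archi_boundP _) _; first by rewrite invr_ge0 ltW.
      by rewrite ler_nat (leq_trans (leq_maxl _ (Num.bound (1 - x)^-1)))// leqW.
    have my : (1 - x)^-1 < m.+2%:R.
      apply: lt_le_trans (archi_boundP _) _; first by rewrite invr_ge0 subr_ge0 ltW.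
      by rewrite ler_nat (leq_trans (leq_maxr (Num.bound x^-1) _))// leqW.
    exists m => //; rewrite /F /= in_itv /=; apply/andP; split.
      by rewrite -[leRHS]invrK lef_pV2 ?posrE ?invr_gt0// ltW.
    rewrite lerBrDl -lerBrDr -[leRHS]invrK lef_pV2 ?posrE ?invr_gt0 ?subr_gt0//.
    exact: ltW.
  move=> [n _]; rewrite /F /= in_itv /= => /andP[h1 h2].
  have : 0 < n.+2%:R^-1 :> R by rewrite invr_gt0.
  move=> ?; apply/andP; split; first exact: lt_le_trans h1.
  by apply: le_lt_trans h2 _; rewrite ltrBlDr ltrDl.
apply: (@le_lt_trans _ _ C%:E); last exact: ltry.
rewrite FU.
have h : (\int[mu]_(x in F i) (f x)%:E)%E @[i --> \oo] -->
    (\int[mu]_(x in \bigcup_i F i) (f x)%:E)%E.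
  apply: ge0_nondecreasing_set_cvg_integral => //.
  - move=> m n mn; apply/subsetPset => x; rewrite /F /= !in_itv /=.
    have : n.+2%:R^-1 <= m.+2%:R^-1 :> R by rewrite lef_pV2 ?posrE// ler_nat !ltnS.
    by move=> mn' /andP[h1 h2]; rewrite (le_trans mn' h1) (le_trans h2)// lerB.
  - by move=> n; exact: measurable_itv.
  - by move=> n; apply/measurable_EFinP; exact: measurable_funTS.
  - by move=> n x _; rewrite lee_fin.
rewrite -(cvg_lim _ h)//; apply: lime_le; first exact: cvgP h.
apply: nearW => n; apply: fC; rewrite invr_gt0 ltr0n/=.
by rewrite lef_pV2 ?posrE// ler_nat.
Qed.

Lemma integrable_powR r : r < 1 ->
  mu.-integrable `]0%R, 1%R[ (EFin \o (fun x => x `^ (- r) + (1 - x) `^ (- r))).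
Proof.
move=> r1; pose p := 1 - r.
have p0 : 0 < p by rewrite subr_gt0.
have -> : - r = p - 1 by rewrite /p addrAC subrr add0r.
have le1 e : 0 < e -> (((1 - e `^ p) / p)%:E <= p^-1%:E)%E.
  by move=> e0; rewrite lee_fin ler_piMl ?invr_ge0 ?(ltW p0)// lerBlDr lerDl powR_ge0.
have i1 : mu.-integrable `]0%R, 1%R[ (EFin \o (fun x => x `^ (p - 1))).
  apply: (@integrable_oo01 _ p^-1) => [|x|]; [exact: measurable_powR|exact: powR_ge0|].
  move=> e /andP[e0 e2]; apply: le_trans (le1 e e0).
  rewrite -integral_powR_pos//; last by apply/andP; split; lra.
  apply: ge0_subset_integral => //.
    by apply/measurable_EFinP; apply: measurable_funTS; exact: measurable_powR.
    by move=> x _; rewrite lee_fin powR_ge0.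
  by move=> x /=; rewrite !in_itv /= => /andP[? ?]; apply/andP; split; lra.
have i2 : mu.-integrable `]0%R, 1%R[ (EFin \o (fun x => (1 - x) `^ (p - 1))).
  apply: (@integrable_oo01 _ p^-1) => [|x|]; [exact: measurable_powR_onem|exact: powR_ge0|].
  move=> e /andP[e0 e2]; apply: le_trans (le1 e e0).
  rewrite -integral_powR_onem_pos//; last by apply/andP; split; lra.
  apply: ge0_subset_integral => //.
    by apply/measurable_EFinP; apply: measurable_funTS; exact: measurable_powR_onem.
    by move=> x _; rewrite lee_fin powR_ge0.
  by move=> x /=; rewrite !in_itv /= => /andP[? ?]; apply/andP; split; lra.
exact: integrableD i1 i2.
Qed.

End convergence.

(** * Convergence of the Riemann sums to the integral *)

Section integral.
Variable R : realType.
Implicit Types x s g p e : R.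
Notation mu := (@lebesgue_measure R).

Definition integrand s g x : R := weight x * bracket s g (cfun x) x.

Lemma cfunB x : cfun (1 - x) = 1 - cfun x.
Proof. by rewrite /cfun; ring. Qed.

(** The constants match those of [growthC_bound], so that [weight_bracket_bound] applies to the
    limit and to the sums alike. *)
Lemma cfun_bound x : 0 < x < 1 -> 2^-1 * x ^+ 2 <= cfun x <= 12 * x ^+ 2.
Proof.
by move=> /andP[x0 x1]; rewrite /cfun; apply/andP; split; nra.
Qed.

Lemma IintE alpha beta :
  Iint alpha beta = (\int[mu]_(x in `]0%R, 1%R[) (integrand (alpha + 1) beta x)%:E)%E.
Proof.
by apply: eq_integral => x _; rewrite /integrand /weight /bracket -cfunB.
Qed.

Lemma measurable_integrand s g : measurable_fun (`]0, 1[%classic : set R) (integrand s g).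
Proof.
pose f x := x `^ (- (3 / 2)) * (1 - x) `^ (- (3 / 2)) * bracket s g (cfun x) x.
apply: (@eq_measurable_fun _ _ _ _ _ f).
  by move=> x /set_mem /= x01; rewrite /integrand weightE.
apply: measurable_funTS; apply: measurable_funM.
  by apply: measurable_funM; [exact: measurable_powR|exact: measurable_powR_onem].
have mc : measurable_fun setT (@cfun R).
  apply: measurable_funM; first exact: measurable_funX.
  by apply: measurable_funB => //; exact: measurable_funM.
apply: measurable_funB => //; apply: measurable_funD; apply: measurable_funM.
- rewrite (_ : (fun x => _) = (@powR R ^~ s) \o (@cfun R))//.
  by apply: measurableT_comp => //; exact: measurable_powR.
- exact: measurable_powR.
- rewrite (_ : (fun x => _) = (fun x => (1 - x) `^ s) \o (@cfun R))//.
  by apply: measurableT_comp => //; exact: measurable_powR_onem.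
- exact: measurable_powR_onem.
Qed.

Lemma integrable_integrand s g : g < 2 * s - 2^-1 ->
  mu.-integrable `]0%R, 1%R[ (EFin \o integrand s g).
Proof.
move=> gs.
have [r /andP[r0 r1] [M M0 bd]] := @weight_bracket_bound R s g 2^-1 12 ltac:(lra) gs.
have iM : mu.-integrable `]0%R, 1%R[
    (fun x => (M%:E * (x `^ (- r) + (1 - x) `^ (- r))%R%:E)%E).
  by apply: integrableZl => //; exact: integrable_powR.
apply: le_integrable iM => //.
  by apply/measurable_EFinP; exact: measurable_integrand.
move=> x /=; rewrite in_itv /= => x01.
rewrite lee_fin [leRHS]ger0_norm; last by rewrite mulr_ge0// addr_ge0 ?powR_ge0.
apply: bd => //; first exact: cfun_bound.
by rewrite -cfunB cfun_bound//; move: x01 => /andP[? ?]; apply/andP; split; lra.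
Qed.

Definition discrete_integrand s g (n a : nat) : R :=
  catalan_scaled R a * catalan_scaled R (n - a) *
    (weight (a.+1%:R / n.+2%:R) *
     bracket s g (growthC R a (n - a)) (a.+1%:R / n.+2%:R)).

Lemma cell_ratio_01 n x : 0 < x < 1 -> 2^-1 * x <= cell_ratio n x < 1.
Proof.
move=> x01; have /andP[h1 _] := cell_ratio_itv n x01; have /andP[x0 x1] := x01.
apply/andP; split.
  apply: le_trans h1; rewrite mulrC ler_pM2l// lerBrDl -lerBrDr.
  have -> : 1 - 2^-1 = 2^-1 :> R by field.
  by rewrite lef_pV2 ?posrE// ler_nat.
by rewrite -subr_gt0 cell_ratioB// divr_gt0.
Qed.

Lemma cell_ratioB_ge n x : 0 < x < 1 -> 2^-1 * (1 - x) <= 1 - cell_ratio n x.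
Proof.
move=> x01; have /andP[_ h1] := cell_ratio_itv n x01; have /andP[x0 x1] := x01.
have : (1 - x) / n.+2%:R <= (1 - x) * 2^-1.
  by rewrite ler_pM2l ?subr_gt0// lef_pV2 ?posrE// ler_nat.
by move: (_ / n.+2%:R) h1 => t; lra.
Qed.

(** The kernel bound holds at the sample point. Since that point is at least [x/2] and its distance
    to 1 at least [(1 - x)/2], passing to [x] costs a factor [2^r], and the majorant no longer
    depends on [n]. *)
Lemma discrete_integrand_bound s g : g < 2 * s - 2^-1 ->
  exists2 r : R, r < 1 & exists M : R, forall n x, 0 < x < 1 ->
  `|discrete_integrand s g n (cell n x)| <= M * (x `^ (- r) + (1 - x) `^ (- r)).
Proof.
move=> gs.
have [r /andP[r0 r1] [M M0 bd]] := @weight_bracket_bound R s g 2^-1 12 ltac:(lra) gs.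
exists r => //; exists (M * 2^-1 `^ (- r)) => n x x01.
have /andP[y0 y1] := cell_ratio_01 n x01.
have /andP[x0 x1] := x01.
have z0 := cell_ratioB_ge n x01.
have half t z : 0 < t -> 2^-1 * t <= z -> z `^ (- r) <= 2^-1 `^ (- r) * t `^ (- r).
  move=> t0 tz; rewrite -powRM ?(ltW t0)// !powRN.
  by rewrite lef_pV2 ?posrE ?powR_gt0 ?ge0_ler_powR ?nnegrE//; lra.
rewrite /discrete_integrand -/(cell_ratio n x) normrM.
apply: (@le_trans _ _ (1 * (M * (cell_ratio n x `^ (- r) + (1 - cell_ratio n x) `^ (- r))))).
  apply: ler_pM => //.
    rewrite ger0_norm; last by rewrite mulr_ge0// ltW// catalan_scaled_gt0.
    by rewrite mulr_ile1 ?catalan_scaled_le1// ltW// catalan_scaled_gt0.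
  apply: bd; first by apply/andP; split => //; lra.
    by have := growthC_bound R (cell n x) (n - cell n x); rewrite subnKC ?cell_le.
  rewrite growthCB cell_ratioB//.
  have := growthC_bound R (n - cell n x) (cell n x).
  by rewrite subnK ?cell_le.
rewrite mul1r -mulrA ler_wpM2l// mulrDr lerD//; apply: half => //.
lra.
Qed.

(** The factor [l] is the square of the limit of [catalan_scaled]: for fixed [x] both [cell n x] and
    [n - cell n x] tend to infinity. *)
Lemma cvg_discrete_integrand s g : exists2 l : R, 0 < l &
  forall x, 0 < x < 1 ->
  discrete_integrand s g n (cell n x) @[n --> \oo] --> l * integrand s g x.
Proof.
have [l l0 ql] := catalan_scaled_cvg R.
exists (l * l) => [|x x01]; first exact: mulr_gt0.
have /andP[x0 x1] := x01.
have y := cvg_cell_ratio x01; have u := cvg_growthC_cell x01.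
have y' : 1 - cell_ratio n x @[n --> \oo] --> 1 - x.
  by apply: cvgB => //; exact: cvg_cst.
have u' : 1 - growthC R (cell n x) (n - cell n x) @[n --> \oo] --> 1 - cfun x.
  by apply: cvgB => //; exact: cvg_cst.
have /andP[c0 _] := cfun_bound x01.
have c00 : 0 < cfun x by apply: lt_le_trans c0; rewrite mulr_gt0// exprn_gt0.
have c1 : 0 < 1 - cfun x.
  have x01' : 0 < 1 - x < 1 by apply/andP; split; lra.
  have /andP[c1 _] := cfun_bound x01'.
  by rewrite -cfunB; apply: lt_le_trans c1; rewrite mulr_gt0// exprn_gt0// subr_gt0.
have x1' : 0 < 1 - x by rewrite subr_gt0.
apply: cvgM; first apply: cvgM.
- exact: (cvg_comp _ _ (cvg_cell x0) ql).
- exact: (cvg_comp _ _ (cvg_sub_cell x01) ql).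
apply: cvgM.
  rewrite (weightE x01).
  under eq_cvg => n.
    rewrite -/(cell_ratio n x) weightE; last first.
      have /andP[? ?] := cell_ratio_01 n x01; apply/andP; split => //; lra.
    over.
  by apply: cvgM; exact: cvg_powR.
apply: cvgB; last exact: cvg_cst.
by apply: cvgD; apply: cvgM; exact: cvg_powR.
Qed.

(** The normalised sum is the integral of a step function, and dominated convergence applies with
    the majorant of [discrete_integrand_bound]. *)
Lemma cvg_riemann_sum s g : g < 2 * s - 2^-1 -> exists2 l : R, 0 < l &
  (n.+1%:R^-1 * \sum_(a < n.+1) discrete_integrand s g n a)%:E @[n --> \oo] -->
  (l%:E * \int[mu]_(x in `]0%R, 1%R[) (integrand s g x)%:E)%E.
Proof.
move=> gs; have [l l0 cv] := cvg_discrete_integrand s g; exists l => //.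
have [r r1 [M bd]] := discrete_integrand_bound gs.
rewrite -integralZl//; last exact: integrable_integrand.
under eq_cvg do rewrite -integral_step_fun.
have iM : mu.-integrable `]0%R, 1%R[
    (fun x => (M%:E * (x `^ (- r) + (1 - x) `^ (- r))%R%:E)%E).
  by apply: integrableZl => //; exact: integrable_powR.
have [|||||_ _ //] := @dominated_convergence _ _ _ mu `]0%R, 1%R[
  _ (fun n x => (step_fun (discrete_integrand s g n) n x)%:E)
  (fun x => (l%:E * (integrand s g x)%:E)%E)
  (fun x => (M%:E * (x `^ (- r) + (1 - x) `^ (- r))%R%:E)%E) _ _ _ iM.
- exact: measurable_itv.
- move=> n; apply/measurable_EFinP; apply: measurable_funTS; exact: measurable_step_fun.
- by apply/measurable_EFinP; apply: measurable_funM => //; exact: measurable_integrand.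
- apply: aeW => x /=; rewrite in_itv /= => x01.
  rewrite -EFinM; apply: cvg_EFin; first by apply: nearW.
  under eq_cvg do rewrite /= step_funE//.
  exact: cv.
- apply: aeW => x n /=; rewrite in_itv /= => x01.
  by rewrite step_funE// lee_fin; exact: bd.
Qed.

End integral.

(** * The root of the integral *)

Section root.
Variables (R : realType) (s : R).
Implicit Types x g p e : R.
Notation mu := (@lebesgue_measure R).
Let J g : \bar R := (\int[mu]_(x in `]0%R, 1%R[) (integrand s g x)%:E)%E.

Lemma powR_exp_anti x g g' : 0 < x <= 1 -> g <= g' -> x `^ (- g) <= x `^ (- g').
Proof. by move=> x01 gg; apply: ger_powR => //; rewrite lerN2. Qed.

Lemma cfun_gt0 x : 0 < x < 1 -> 0 < cfun x.
Proof.
move=> x01; have /andP[+ _] := cfun_bound x01; apply: lt_le_trans.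
by rewrite mulr_gt0// exprn_gt0//; case/andP: x01.
Qed.

Lemma integrand_le x g g' : 0 < x < 1 -> g <= g' -> integrand s g x <= integrand s g' x.
Proof.
move=> /andP[x0 x1] gg; rewrite ler_wpM2l ?weight_ge0// lerD2r.
by rewrite lerD// ler_wpM2l ?powR_ge0// powR_exp_anti//; apply/andP; split; lra.
Qed.

Lemma integrand_lt x g g' : 0 < x < 1 -> g < g' -> integrand s g x < integrand s g' x.
Proof.
move=> x01 gg; have /andP[x0 x1] := x01.
rewrite ltr_pM2l ?weight_gt0// ltrD2r ltr_leD//; last first.
  by rewrite ler_wpM2l ?powR_ge0// powR_exp_anti ?(ltW gg)//; apply/andP; split; lra.
rewrite ltr_pM2l ?powR_gt0 ?cfun_gt0// /powR gt_eqF// ltr_expR.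
have : ln x < 0 by rewrite ln_lt0.
nra.
Qed.

(* Since [+oo - +oo = -oo], a vanishing integral has finite positive and negative
   parts. *)
Lemma integral0_integrable g : J g = 0%E ->
  mu.-integrable `]0%R, 1%R[ (EFin \o integrand s g).
Proof.
move=> J0; have mf : measurable_fun (`]0, 1[%classic : set R) (EFin \o integrand s g).
  by apply/measurable_EFinP; exact: measurable_integrand.
apply/integrableP; split => //.
move: J0; rewrite /J integralE.
change (\int[mu]_(x in `]0%R, 1%R[) (EFin \o integrand s g)^\+ x -
  \int[mu]_(x in `]0%R, 1%R[) (EFin \o integrand s g)^\- x = 0 ->
  \int[mu]_(x in `]0%R, 1%R[) (abse \o (EFin \o integrand s g)) x < +oo)%E.
rewrite fune_abse ge0_integralD//; last 2 first.
- exact: measurable_funepos.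
- exact: measurable_funeneg.
have : (0 <= \int[mu]_(x in `]0%R, 1%R[) (EFin \o integrand s g)^\+ x)%E by exact: integral_ge0.
have : (0 <= \int[mu]_(x in `]0%R, 1%R[) (EFin \o integrand s g)^\- x)%E by exact: integral_ge0.
move: (\int[_]_(x in _) _ x)%E (\int[_]_(x in _) _ x)%E => [a| |] [b| |] //= _ _ _.
exact: ltry.
Qed.

(** The difference of the integrands is positive on []0, 1[]. A zero integral would make it vanish
    almost everywhere, hence make an interval of length 1 negligible. *)
Lemma integral_integrand_lt g g' :
  mu.-integrable `]0%R, 1%R[ (EFin \o integrand s g) ->
  mu.-integrable `]0%R, 1%R[ (EFin \o integrand s g') ->
  g < g' -> (J g < J g')%E.
Proof.
move=> ig ig' gg.
have dpos x : `]0, 1[%classic x -> 0 < integrand s g' x - integrand s g x.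
  by rewrite /= in_itv /= => x01; rewrite subr_gt0 integrand_lt.
have id : mu.-integrable `]0%R, 1%R[
    (fun x => ((integrand s g' x)%:E - (integrand s g x)%:E)%E).
  exact: integrableB.
rewrite -sube_gt0 /J -integralB_EFin//.
rewrite lt_neqAle integral_ge0 ?andbT => [|x x01]; last by rewrite lee_fin ltW// dpos.
apply/eqP => /esym h.
have : ae_eq mu [set` `]0%R, 1%R[]
    (fun x => ((integrand s g' x)%:E - (integrand s g x)%:E)%E) (cst 0%E).
  apply/ae_eq_integral_abs => //; first exact: measurable_int id.
  rewrite -h; apply: eq_integral => x /set_mem x01.
  by rewrite gee0_abs// -EFinB lee_fin ltW// dpos.
move=> ae0; have : mu.-negligible [set` `]0%R, 1%R[].
  apply: negligibleS ae0 => x x01 /= /(_ x01)/eqP.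
  by rewrite -EFinB eqe gt_eqF// dpos.
move/negligibleP => /(_ (measurable_itv _)).
by rewrite /= lebesgue_measure_itv /= lte_fin ltr01 oppr0 adde0 => /eqP; rewrite eqe oner_eq0.
Qed.

(** Adding [H] makes [f] nonnegative, after which the domain may shrink to [A] and the integrand to
    [h]. Both sign results below use it, with [f] the integrand or its opposite. *)
Lemma integral_lower_bound (f H h : R -> R) (A : set R) :
  mu.-integrable `]0%R, 1%R[ (EFin \o f) -> mu.-integrable `]0%R, 1%R[ (EFin \o H) ->
  (forall x, 0 < x < 1 -> 0 <= f x + H x) ->
  measurable A -> A `<=` `]0, 1[ ->
  measurable_fun A h -> (forall x, A x -> 0 <= h x <= f x + H x) ->
  (\int[mu]_(x in A) (h x)%:E <=
   \int[mu]_(x in `]0%R, 1%R[) (f x)%:E + \int[mu]_(x in `]0%R, 1%R[) (H x)%:E)%E.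
Proof.
move=> fi Hi fH0 mA A01 mh hb.
have iD : mu.-integrable `]0%R, 1%R[ (fun x => ((f x)%:E + (H x)%:E)%E).
  exact: integrableD.
rewrite -integralD_EFin//.
have mfH := measurable_int mu iD.
apply: (@le_trans _ _ (\int[mu]_(x in A) ((f x)%:E + (H x)%:E))%E).
  apply: ge0_le_integral => //.
  - by move=> x /hb /andP[h0 _]; rewrite lee_fin.
  - exact/measurable_EFinP.
  - exact: measurable_funS mfH.
  - by move=> x /hb /andP[_ ?]; rewrite lee_fin.
apply: ge0_subset_integral => //.
Qed.

Lemma powR_ge_inv a k K x : 0 < k -> k <= x <= K ->
  (k `^ (- a) + K `^ (- a))^-1 <= x `^ a.
Proof.
move=> k0 kxK; have /andP[kx _] := kxK; have x0 := lt_le_trans k0 kx.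
rewrite -[x `^ a]invrK -powRN lef_pV2 ?posrE ?powR_gt0//; last first.
  by rewrite ltr_pwDl ?powR_gt0// powR_ge0.
exact: powR_le_sum.
Qed.

Lemma continuous_integrand x : 0 < x < 1 -> continuous (fun g => integrand s g x).
Proof.
move=> /andP[x0 x1] g.
have c y : 0 < y -> {for g, continuous (fun g : R => y `^ (- g))}.
  move=> y0.
  rewrite (_ : (fun g => _) = (fun g => expR (- g * ln y))); last first.
    by apply/funext => t; rewrite /powR gt_eqF.
  have h : (- t * ln y) @[t --> g] --> - g * ln y.
    by apply: cvgM; [exact: cvgN|exact: cvg_cst].
  exact: (continuous_cvg _ (@continuous_expR R _) h).
apply: cvgM; first exact: cvg_cst.
apply: cvgB; last exact: cvg_cst.
by apply: cvgD; apply: cvgM; [exact: cvg_cst|exact: c|exact: cvg_cst|apply: c; rewrite subr_gt0].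
Qed.

(** Monotonicity in [g] bounds the integrand on []u, v[] by the sum of its absolute values at [u]
    and [v], which is an integrable majorant. *)
Lemma continuous_integral u v : v < 2 * s - 2^-1 ->
  {in `]u, v[, continuous (fun g => (\int[mu]_(x in `]0%R, 1%R[) integrand s g x)%R)}.
Proof.
move=> vs g guv.
have uv : u < v by move: guv; rewrite in_itv /= => /andP[/lt_trans]; apply.
have iu := integrable_integrand (lt_trans uv vs).
have iv := integrable_integrand vs.
apply: (@continuity_under_integral _ _ _ mu (fun g x => integrand s g x) `]0%R, 1%R[ _
  u v _ _ (fun x => `|integrand s u x| + `|integrand s v x|)) => //.
- move=> t /=; rewrite in_itv /= => /andP[_ tv].
  exact: integrable_integrand (lt_trans tv vs).
- apply: aeW => x /=; rewrite in_itv /= => x01 t _; exact: continuous_integrand.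
- have := integrableD _ (integrable_abse iu) (integrable_abse iv).
  exact.
- move=> t /=; rewrite in_itv /= => /andP[ut tv].
  apply: aeW => x /=; rewrite in_itv /= => x01.
  have h1 := integrand_le x01 (ltW ut); have h2 := integrand_le x01 (ltW tv).
  rewrite ler_norml; apply/andP; split.
    have := ler_norm (- integrand s u x); rewrite normrN.
    have := normr_ge0 (integrand s v x); lra.
  have := ler_norm (integrand s v x).
  have := normr_ge0 (integrand s u x); lra.
- by apply/mem_set.
Qed.

(* As [g] tends to [-oo] the integrand decreases to [- weight], which is not
   integrable; for [g = g0 - M] with [M = 2 t^2] it is already enough to look at
   the interval [1/M, 1/t^2], which contributes at most [- t k / 4]. *)
Lemma exists_integral_lt0 : exists2 g, g < 2 * s - 2^-1 & (J g < 0)%E.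
Proof.
pose g0 := 2 * s - 1.
have i0 : mu.-integrable `]0%R, 1%R[ (EFin \o integrand s g0).
  by apply: integrable_integrand; rewrite /g0; lra.
pose H x : R := `|integrand s g0 x|.
have iH : mu.-integrable `]0%R, 1%R[ (EFin \o H) by exact: integrable_abse i0.
pose B := fine (\int[mu]_(x in `]0%R, 1%R[) (H x)%:E).
have BE : (\int[mu]_(x in `]0%R, 1%R[) (H x)%:E)%E = B%:E.
  by rewrite /B fineK//; exact: integrable_fin_num iH.
have B0 : 0 <= B.
  by rewrite -lee_fin -BE; apply: integral_ge0 => x _; rewrite lee_fin normr_ge0.
(* A lower bound for [(1 - cfun x)^s (1 - x)^(- g0)] when [x <= 1/4], where [1 - cfun x] lies in
   [[1/8, 1]] and [1 - x] in [[1/2, 1]]. *)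
pose k : R := (8^-1 `^ (- s) + 1 `^ (- s))^-1 * (2^-1 `^ (- (- g0)) + 1 `^ (- (- g0)))^-1.
have k0 : 0 < k.
  by rewrite mulr_gt0// invr_gt0 ltr_pwDl ?powR_gt0 ?powR_ge0.
(* Chosen so that [t k / 4 = B + k / 2] exceeds [B]; the 2 gives [t^2 >= 4], which keeps the
   interval below [1/4]. *)
pose t := 2 + 4 * B / k.
have t2 : 2 <= t by rewrite lerDl divr_ge0 ?mulr_ge0// ltW.
have t0 : 0 < t by lra.
pose M := 2 * t ^+ 2.
have M0 : 0 < M by rewrite mulr_gt0// exprn_gt0.
exists (g0 - M); first by rewrite /g0; lra.
have ig : mu.-integrable `]0%R, 1%R[ (EFin \o integrand s (g0 - M)).
  by apply: integrable_integrand; rewrite /g0; lra.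
have ign : mu.-integrable `]0%R, 1%R[ (EFin \o (fun x => - integrand s (g0 - M) x)).
  exact: integrableN ig.
have tsq : 4 <= t ^+ 2 by nra.
(* This is [(1 - z)^M <= exp(- M z) <= exp(-1) <= 1/2]. *)
have half z : 0 < z < 1 -> 1 <= M * z -> (1 - z) `^ M <= 2^-1.
  move=> /andP[z0 z1] Mz; rewrite /powR gt_eqF ?subr_gt0//.
  have -> : 2^-1 = (1 + 1)^-1 :> R by [].
  apply: (@le_trans _ _ (expR (- 1))).
    rewrite ler_expR; have := @le_ln1Dx R (- z) ltac:(lra).
    by nra.
  by rewrite expRN lef_pV2 ?posrE ?expR_gt0// expR_ge1Dx.
have itsq : (t ^+ 2)^-1 <= 4^-1 by rewrite lef_pV2 ?posrE// exprn_gt0.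
have A01 x : M^-1 <= x <= (t ^+ 2)^-1 -> 0 < x <= 4^-1.
  move=> /andP[Mx xt]; apply/andP; split; last exact: le_trans xt itsq.
  by apply: lt_le_trans Mx; rewrite invr_gt0.
(* On this interval [x <= 1/t^2] gives weight at least [t^3], and passing from [g0] to [g0 - M]
   lowers the bracket by at least [k/2]. The length is [1/(2 t^2)], so the left side is
   [t k / 4]. *)
have h : (\int[mu]_(x in `[(M^-1)%R, ((t ^+ 2)^-1)%R]) (t ^+ 3 * (k / 2))%:E <=
  \int[mu]_(x in `]0%R, 1%R[) (- integrand s (g0 - M) x)%:E +
  \int[mu]_(x in `]0%R, 1%R[) (H x)%:E)%E.
  apply: integral_lower_bound => //.
  - move=> x x01; have := ler_norm (integrand s g0 x).
    have : integrand s (g0 - M) x <= integrand s g0 x.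
      by apply: integrand_le => //; rewrite lerBlDr lerDl ltW.
    by rewrite /H; lra.
  - move=> x /=; rewrite !in_itv /= => /A01/andP[? ?]; apply/andP; split => //; lra.
  - move=> x /=; rewrite in_itv /= => xA; have /andP[x0 x4] := A01 x xA.
    have /andP[Mx xt] := xA.
    have x01 : 0 < x < 1 by apply/andP; split => //; lra.
    have t30 : 0 < t ^+ 3 by rewrite exprn_gt0.
    apply/andP; split; first by rewrite mulr_ge0 ?divr_ge0 ?(ltW t30) ?(ltW k0).
    apply: (@le_trans _ _ (integrand s g0 x - integrand s (g0 - M) x)); last first.
      by rewrite addrC lerD2l ler_norm.
    have wt : t ^+ 3 <= weight x.
      rewrite /weight div1r -[leLHS]invrK lef_pV2 ?posrE ?invr_gt0 ?sqrtr_gt0//; last first.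
        by rewrite mulr_gt0// exprn_gt0// subr_gt0; lra.
      have -> : (t ^+ 3)^-1 = Num.sqrt ((t ^+ 2)^-1 ^+ 3).
        rewrite -[LHS]ger0_norm ?invr_ge0 ?(ltW t30)// -sqrtr_sqr.
        by congr Num.sqrt; field; rewrite gt_eqF.
      rewrite ler_wsqrtr//.
      apply: (@le_trans _ _ (x ^+ 3)).
        by rewrite ler_piMr ?exprn_ge0 ?(ltW x0)// exprn_ile1//; lra.
      by rewrite lerXn2r ?nnegrE ?(ltW x0)// invr_ge0 sqr_ge0.
    have kb : k <= (1 - cfun x) `^ s * (1 - x) `^ (- g0).
      apply: ler_pM; rewrite ?invr_ge0 ?addr_ge0 ?powR_ge0//.
        apply: powR_ge_inv => //; apply/andP; split; last by rewrite lerBlDr lerDl ltW// cfun_gt0.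
        have x01' : 0 < 1 - x < 1 by apply/andP; split; lra.
        have /andP[+ _] := cfun_bound x01'; rewrite cfunB; apply: le_trans; nra.
      by apply: powR_ge_inv => //; apply/andP; split; lra.
    have Mx1 : 1 <= M * x by rewrite mulrC -ler_pdivrMr// div1r.
    have hx := half x x01 Mx1.
    have e1 : (1 - x) `^ (- (g0 - M)) = (1 - x) `^ (- g0) * (1 - x) `^ M.
      have y0 : 0 < 1 - x by rewrite subr_gt0; lra.
      by rewrite opprB [M - g0]addrC powRD// (gt_eqF y0) implybT.
    have e2 : x `^ (- (g0 - M)) <= x `^ (- g0).
      by apply: powR_exp_anti; [apply/andP; split; lra|lra].
    rewrite /integrand -mulrBr /bracket e1.
    have c0 := powR_ge0 (cfun x) s.
    apply: ler_pM => //; [exact: ltW|by rewrite divr_ge0// ltW|].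
    move: kb hx; rewrite mulrA.
    set P := (1 - cfun x) `^ s * _; set Q := (1 - x) `^ M => kb hx.
    by nra.
have -> : (0%E : \bar R) = 0%:E by [].
have JE : J (g0 - M) = (fine (J (g0 - M)))%:E by rewrite fineK//; exact: integrable_fin_num ig.
rewrite JE lte_fin; move: h.
have -> : (\int[mu]_(x in `]0%R, 1%R[) (- integrand s (g0 - M) x)%:E = - J (g0 - M))%E.
  under eq_integral do rewrite EFinN.
  by rewrite integralN//; exact: integrable_add_def.
rewrite BE JE.
rewrite (integral_cst mu (measurable_itv _)) /= lebesgue_measure_itv /= lte_fin.
rewrite ltf_pV2 ?posrE ?exprn_gt0//.
have -> : t ^+ 2 < M by rewrite /M; lra.
rewrite -!EFinD -EFinM lee_fin.
have -> : t ^+ 3 * (k / 2) * ((t ^+ 2)^-1 - M^-1) = t * k / 4.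
  by rewrite /M; field; rewrite gt_eqF.
have -> : t * k / 4 = k / 2 + B by rewrite /t; field; rewrite gt_eqF.
lra.
Qed.

(* For [g = 2 s - 1/2 - p] the integrand dominates [k x^(p-1)] up to a function
   independent of [p], and the integral of [x^(p-1)] is [1/p]. *)
Lemma exists_integral_gt0 : exists2 g, g < 2 * s - 2^-1 & (0 < J g)%E.
Proof.
pose g0 := 2 * s - 3 / 2.
have i0 : mu.-integrable `]0%R, 1%R[ (EFin \o integrand s g0).
  by apply: integrable_integrand; rewrite /g0; lra.
pose k : R := (2^-1 `^ (- s) + 12 `^ (- s))^-1.
have k0 : 0 < k by rewrite invr_gt0 ltr_pwDl ?powR_gt0 ?powR_ge0.
(* At [g0] the power [x^(2 s - g0 - 3/2)] is identically 1, so the integrand at [g] exceeds that at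
   [g0] by at least [k (x^(p-1) - 1)]. [H] absorbs the integrand at [g0] and the constant [k]. *)
pose H x : R := `|integrand s g0 x| + k.
have ik : mu.-integrable `]0%R, 1%R[ (EFin \o (fun=> k)).
  apply: measurable_bounded_integrable => //.
    by rewrite /= lebesgue_measure_itv /= lte_fin ltr01 -EFinB ltry.
  exact: bounded_cst.
have iH : mu.-integrable `]0%R, 1%R[ (EFin \o H).
  have := integrableD _ (integrable_abse i0) ik; exact.
pose B := fine (\int[mu]_(x in `]0%R, 1%R[) (H x)%:E).
have BE : (\int[mu]_(x in `]0%R, 1%R[) (H x)%:E)%E = B%:E.
  by rewrite /B fineK//; exact: integrable_fin_num iH.
have H0 x : 0 <= H x by rewrite addr_ge0// ltW.
have B0 : 0 <= B.
  by rewrite -lee_fin -BE; apply: integral_ge0 => x _; rewrite lee_fin H0.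
(* Makes [k / (2 p) = B + k], which exceeds [B]. *)
pose p := k / (2 * (B + k)).
have Bk0 : 0 < B + k by rewrite ltr_wpDl.
have p0 : 0 < p by rewrite divr_gt0// mulr_gt0.
have p2 : p <= 2^-1.
  by rewrite /p ler_pdivrMr ?mulr_gt0//; lra.
(* With [e^p = 1/2], the integral of [x^(p-1)] over [[e, 1]] is [1/(2 p)]. *)
pose e : R := 2^-1 `^ p^-1.
have ep : e `^ p = 2^-1 by rewrite -powRrM mulVf ?gt_eqF// powRr1.
have e0 : 0 < e by rewrite powR_gt0.
have e1 : e < 1.
  rewrite ltNge; apply/negP => e1; have := ler_powR e1 (ltW p0).
  by rewrite powRr0 ep; lra.
pose g := 2 * s - 2^-1 - p.
have gs : g < 2 * s - 2^-1 by rewrite /g; lra.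
have g0g : g0 <= g by rewrite /g0 /g; lra.
exists g => //.
have ig := integrable_integrand gs.
have h : (\int[mu]_(x in `[e, 1%R[) (k * x `^ (p - 1))%:E <=
  \int[mu]_(x in `]0%R, 1%R[) (integrand s g x)%:E +
  \int[mu]_(x in `]0%R, 1%R[) (H x)%:E)%E.
  apply: integral_lower_bound => //.
  - move=> x x01; have := ler_norm (- integrand s g0 x); rewrite normrN.
    by have := integrand_le x01 g0g; rewrite /H; lra.
  - move=> x /=; rewrite !in_itv /= => /andP[ex x1]; apply/andP; split => //.
    exact: lt_le_trans ex.
  - by apply: measurable_funTS; apply: measurable_funM => //; exact: measurable_powR.
  - move=> x /=; rewrite in_itv /= => /andP[ex x1].
    have x0 := lt_le_trans e0 ex.
    have x01 : 0 < x < 1 by rewrite x0.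
    rewrite mulr_ge0 ?powR_ge0 ?(ltW k0)//=.
    suff : k * (x `^ (p - 1) - 1) <= integrand s g x - integrand s g0 x.
      have := ler_norm (- integrand s g0 x); rewrite normrN /H; lra.
    have D a b : x `^ (a + b) = x `^ a * x `^ b by rewrite powRD// (gt_eqF x0) implybT.
    have wx : x `^ (- (3 / 2)) <= weight x.
      rewrite weightE// ler_peMr ?powR_ge0// -[leLHS](powRr0 (1 - x)).
      by apply: ger_powR; [apply/andP; split; lra|lra].
    have cx : k * x `^ (2 * s) <= cfun x `^ s.
      have -> : cfun x `^ s = (cfun x / x ^+ 2) `^ s * x `^ (2 * s).
        rewrite powRrM powR_mulrn ?(ltW x0)// -powRM ?sqr_ge0//.
          by rewrite divfK// expf_neq0// gt_eqF.
        by rewrite divr_ge0 ?sqr_ge0// ltW// cfun_gt0.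
      rewrite ler_wpM2r ?powR_ge0// powR_ge_inv//.
      by rewrite ler_pdivlMr ?exprn_gt0// ler_pdivrMr ?exprn_gt0// cfun_bound.
    have g0E : x `^ (- (3 / 2)) * (x `^ (2 * s) * x `^ (- g0)) = 1.
      by rewrite -!D (_ : _ + _ = 0) ?powRr0// /g0; ring.
    have gE : x `^ (- (3 / 2)) * (x `^ (2 * s) * x `^ (- g)) = x `^ (p - 1).
      by rewrite -!D; congr (_ `^ _); rewrite /g; field.
    have d0 : 0 <= x `^ (- g) - x `^ (- g0).
      by rewrite subr_ge0 powR_exp_anti// x0 ltW.
    have d1 : (1 - x) `^ (- g0) <= (1 - x) `^ (- g).
      by rewrite powR_exp_anti//; apply/andP; split; lra.
    apply: (@le_trans _ _ (weight x * (cfun x `^ s * (x `^ (- g) - x `^ (- g0))))).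
      have -> : k * (x `^ (p - 1) - 1) =
          x `^ (- (3 / 2)) * (k * x `^ (2 * s) * (x `^ (- g) - x `^ (- g0))).
        by rewrite -gE -[X in _ * (_ - X) = _]g0E; ring.
      by apply: ler_pM => //; rewrite ?powR_ge0 ?mulr_ge0 ?powR_ge0 ?(ltW k0) ?ler_wpM2r.
    rewrite /integrand -mulrBr ler_wpM2l ?weight_ge0// /bracket.
    have := ler_wpM2l (powR_ge0 (1 - cfun x) s) d1.
    by lra.
have JE : J g = (fine (J g))%:E by rewrite fineK//; exact: integrable_fin_num ig.
rewrite JE lte_fin; move: h; rewrite -/(J g) BE JE.
under eq_integral do rewrite EFinM.
rewrite ge0_integralZl_EFin//; last 3 first.
- by move=> x _; rewrite lee_fin powR_ge0.
- by apply/measurable_EFinP; apply: measurable_funTS; exact: measurable_powR.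
- exact: ltW.
rewrite integral_itv_bndo_bndc; last first.
  by apply/measurable_EFinP; apply: measurable_funTS; exact: measurable_powR.
rewrite integral_powR_pos//; last by rewrite e0.
rewrite ep -EFinM -EFinD lee_fin.
have -> : k * ((1 - 2^-1) / p) = B + k by rewrite /p; field; rewrite !gt_eqF.
lra.
Qed.

Lemma integral_root : exists2 g, g < 2 * s - 2^-1 & J g = 0%E.
Proof.
have [a abs Ja] := exists_integral_lt0; have [b bbs Jb] := exists_integral_gt0.
have ab : a < b.
  rewrite ltNge; apply/negP; rewrite le_eqVlt => /predU1P[ba|ba].
    by move: Jb; rewrite ba ltNge ltW.
  have := integral_integrand_lt (integrable_integrand bbs) (integrable_integrand abs) ba.
  by rewrite ltNge ltW// (lt_trans Ja).
pose K g := (\int[mu]_(x in `]0%R, 1%R[) integrand s g x)%R.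
have JK g : g < 2 * s - 2^-1 -> J g = (K g)%:E.
  by move=> gs; rewrite /J /K /Rintegral fineK// integrable_fin_num//; exact: integrable_integrand.
(* A point strictly between [b] and the threshold, so that [[a, b]] lies inside the open interval
   []a - 1, v[] of continuity. *)
pose v := (b + (2 * s - 2^-1)) / 2.
have bv : b < v by rewrite /v; lra.
have vs : v < 2 * s - 2^-1 by rewrite /v; lra.
have [||c /[!in_itv] /= /andP[ac cb] Kc] := @IVT R K a b 0 (ltW ab).
- apply: continuous_in_subspaceT => x /set_mem /=; rewrite in_itv /= => /andP[ax xb].
  apply: (continuous_integral (u := a - 1) vs).
  by rewrite in_itv /=; apply/andP; split; lra.
- move: Ja Jb; rewrite !JK// !lte_fin; move: (K a) (K b) => u w u0 w0.
  by rewrite ge_min le_max (ltW u0) (ltW w0) orbT.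
by exists c; [exact: le_lt_trans cb bbs|rewrite JK ?Kc//; exact: le_lt_trans cb bbs].
Qed.

End root.

(** * The growth exponent *)

Section exponent.
Variables (R : realType) (alpha : R).
Notation mu := (@lebesgue_measure R).

Lemma Iint_root : exists2 beta : R, beta < 2 * (alpha + 1) - 2^-1 & Iint alpha beta = 0%E.
Proof.
have [g gs g0] := integral_root (alpha + 1); exists g; first exact: gs.
by rewrite IintE; exact: g0.
Qed.

(** A vanishing integral already gives integrability, so strict monotonicity compares any two roots,
    with no prior bound on either. *)
Lemma Iint_root_unique (b b' : R) : Iint alpha b = 0%E -> Iint alpha b' = 0%E -> b = b'.
Proof.
wlog : b b' / b < b' => [th|bb'].
  by have [//||//] := ltgtP b b' => [/th|/th h /[swap] /h /[apply]]; [exact|].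
rewrite !IintE => h h'.
have := integral_integrand_lt (integral0_integrable h) (integral0_integrable h') bb'.
by rewrite h h' ltxx.
Qed.

Lemma expectation_uniform (d : measure_display) (Omega : measurableType d)
    (P : probability Omega R) (n : nat) (X : Omega -> btree n) (f : btree n -> R) :
  uniform_btree P X ->
  ('E_P[fun omega => f (X omega)] = ((\sum_(t : btree n) f t) / catalan R n)%:E)%E.
Proof.
move=> uX; rewrite unlock.
have mX t : measurable (X @^-1` [set t]) by have [] := uX t.
have iX t : P.-integrable setT (EFin \o (\1_(X @^-1` [set t]) : Omega -> R)).
  exact: integrable_indic.
rewrite (eq_integral (fun omega => \sum_(t : btree n)
  ((f t)%:E * (\1_(X @^-1` [set t]) omega)%:E))%E); last first.
  move=> w _; rewrite (bigD1 (X w)) //= big1 ?adde0 => [|t tX].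
    by rewrite indicE mem_set// mule1.
  rewrite indicE memNset ?mule0//= => Xt.
  by rewrite Xt eqxx in tX.
rewrite integral_sum //=; last by move=> t; exact: (integrableZl _ (f t) (iX t)).
rewrite mulr_suml -sumEFin; apply: eq_bigr => t _.
rewrite (integralZl _ (iX t))// integral_indic// setIT.
have [_ Pt] := uX t.
transitivity ((f t)%:E * (#|{: btree n}|%:R^-1)%:E)%E; last by rewrite -EFinM.
congr (_ * _)%E; exact: Pt.
Qed.

(** The positive [c n] undoes the prefactor of [splitting_operator_powR]. Only its sign matters: the
    sign of [Iint alpha g] decides whether the power is eventually a super- or a subsolution. *)
Lemma near_splitting_operator (g : R) : g < 2 * (alpha + 1) - 2^-1 ->
  exists2 l : R, 0 < l &
  exists c : nat -> R, (forall n, 0 < c n) /\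
   (c n * (splitting_operator alpha (fun k => k.+1%:R `^ (- g)) n -
    catalan R n.+1 * n.+2%:R `^ (- g)))%:E @[n --> \oo] -->
     (l%:E * Iint alpha g)%E.
Proof.
move=> gs; have [l l0 h] := cvg_riemann_sum gs; exists l => //.
exists (fun n => (4 ^+ n / n.+2%:R ^+ 3 * n.+2%:R `^ (- g))^-1 / n.+1%:R); split.
  by move=> n; rewrite divr_gt0// invr_gt0 !mulr_gt0// ?powR_gt0// ?invr_gt0 exprn_gt0.
rewrite IintE; move: h; under eq_cvg => n.
  rewrite (_ : n.+1%:R^-1 * _ = (4 ^+ n / n.+2%:R ^+ 3 * n.+2%:R `^ (- g))^-1 / n.+1%:R *
     (splitting_operator alpha (fun k => k.+1%:R `^ (- g)) n -
      catalan R n.+1 * n.+2%:R `^ (- g))); last first.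
    rewrite (splitting_operator_powR alpha g n) mulrA; congr (_ * _).
    rewrite mulrAC mulVf ?mul1r// gt_eqF// !mulr_gt0 ?powR_gt0 ?invr_gt0 ?exprn_gt0//.
  over.
exact.
Qed.

Lemma near_supersolution (g : R) : g < 2 * (alpha + 1) - 2^-1 -> (Iint alpha g < 0)%E ->
  \forall n \near \oo, splitting_operator alpha (fun k => k.+1%:R `^ (- g)) n <=
    catalan R n.+1 * n.+2%:R `^ (- g).
Proof.
move=> gs I0; have [l l0 [c [c0 h]]] := near_splitting_operator gs.
have L0 : (l%:E * Iint alpha g < 0)%E by rewrite mule_gt0_lt0.
have : \forall n \near \oo, ((c n * (splitting_operator alpha (fun k => k.+1%:R `^ (- g)) n -
    catalan R n.+1 * n.+2%:R `^ (- g)))%:E < 0)%E.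
  by apply: (h [set y | (y < 0)%E]); exact: open_ereal_lt'.
apply: filterS => n; rewrite lte_fin pmulr_rlt0// subr_lt0; exact: ltW.
Qed.

Lemma near_subsolution (g : R) : g < 2 * (alpha + 1) - 2^-1 -> (0 < Iint alpha g)%E ->
  \forall n \near \oo, catalan R n.+1 * n.+2%:R `^ (- g) <=
    splitting_operator alpha (fun k => k.+1%:R `^ (- g)) n.
Proof.
move=> gs I0; have [l l0 [c [c0 h]]] := near_splitting_operator gs.
have L0 : (0 < l%:E * Iint alpha g)%E by rewrite mule_gt0.
have : \forall n \near \oo, (0 < (c n * (splitting_operator alpha (fun k => k.+1%:R `^ (- g)) n -
    catalan R n.+1 * n.+2%:R `^ (- g)))%:E)%E.
  by apply: (h [set y | (0 < y)%E]); exact: open_ereal_gt'.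
apply: filterS => n; rewrite lte_fin pmulr_rgt0// subr_gt0; exact: ltW.
Qed.

Lemma Iint_lt (g g' : R) : g < g' -> g' < 2 * (alpha + 1) - 2^-1 ->
  (Iint alpha g < Iint alpha g')%E.
Proof.
move=> gg gs; rewrite !IintE; apply: integral_integrand_lt => //.
  exact: integrable_integrand (lt_trans gg gs).
exact: integrable_integrand gs.
Qed.

Lemma mean_power_sum_upper (b g : R) : b < 2 * (alpha + 1) - 2^-1 ->
  Iint alpha b = 0%E -> g < b ->
  exists2 K : R, 0 < K & forall n, mean_power_sum alpha n <= K * n.+1%:R `^ (- g).
Proof.
move=> bs b0 gb; apply: (splitting_comparison (alpha := alpha)).
- by move=> n; rewrite powR_gt0.
- exact: mean_power_sum_gt0.
- by apply: near_supersolution; [exact: lt_trans bs|rewrite -b0 Iint_lt].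
- by apply: nearW => n; rewrite splitting_operator_mean_power_sum.
Qed.

Lemma mean_power_sum_lower (b g : R) : b < 2 * (alpha + 1) - 2^-1 ->
  Iint alpha b = 0%E -> b < g ->
  exists2 K : R, 0 < K & forall n, n.+1%:R `^ (- g) <= K * mean_power_sum alpha n.
Proof.
move=> bs b0 bg.
(* Since [g] may lie beyond the threshold, it is lowered to an exponent still above [b] where the
   integral is finite; this only strengthens the lower bound. *)
pose g' := Num.min g ((b + (2 * (alpha + 1) - 2^-1)) / 2).
have g's : g' < 2 * (alpha + 1) - 2^-1 by rewrite /g' gt_min; apply/orP; right; lra.
have bg' : b < g' by rewrite /g' lt_min bg/=; lra.
have g'g : g' <= g by rewrite /g' ge_min lexx.
have [K K0 h] : exists2 K : R, 0 < K & forall n, n.+1%:R `^ (- g') <= K * mean_power_sum alpha n.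
  apply: (splitting_comparison (alpha := alpha)).
  - exact: mean_power_sum_gt0.
  - by move=> n; rewrite powR_gt0.
  - by apply: nearW => n; rewrite splitting_operator_mean_power_sum.
  - by apply: near_subsolution => //; rewrite -b0 Iint_lt.
exists K => // n; apply: le_trans (h n).
by rewrite ler_powR ?lerN2// ler1n.
Qed.

End exponent.

(** * From power bounds to the exponent *)

Lemma near_ln_ge (R : realType) (A : R) : \forall n \near \oo, A <= ln (n%:R : R).
Proof.
exists (Num.bound (expR A)) => // n /= hn.
have h : expR A <= n%:R.
  by apply: le_trans (ltW (archi_boundP (expR_ge0 A))) _; rewrite ler_nat.
by rewrite -[A]expRK ler_ln ?posrE ?expR_gt0// (lt_le_trans (expR_gt0 A)).
Qed.

Lemma near_ln_ratio_le (R : realType) (u : nat -> R) (K g e : R) :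
  0 < e -> 0 < K -> (forall n, 0 < u n) ->
  (forall n, u n <= K * n.+1%:R `^ (- g)) ->
  \forall n \near \oo, ln (u n) / ln n%:R <= - g + e.
Proof.
move=> e0 K0 u0 uK.
(* Absorbs the passage from [n + 1] to [n], their ratio lying in [[1, 2]]. Then [ln C <= e ln n] for
   large [n]. *)
pose C := K * (1 `^ (- g) + 2 `^ (- g)).
have C0 : 0 < C by rewrite mulr_gt0// ltr_pwDl ?powR_gt0 ?powR_ge0.
near=> n.
have n0 : (0 < n)%N by near: n; exact: nbhs_infty_gt.
have nR : 0 < n%:R :> R by rewrite ltr0n.
have ln1 : 1 <= ln (n%:R : R) by near: n; exact: near_ln_ge.
have lnC : ln C / e <= ln (n%:R : R) by near: n; exact: near_ln_ge.
have ln0 : 0 < ln (n%:R : R) by apply: lt_le_trans ln1.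
rewrite ler_pdivrMr//.
have un : u n <= C * n%:R `^ (- g).
  apply: le_trans (uK n) _; rewrite /C -mulrA ler_pM2l//.
  have -> : n.+1%:R = n.+1%:R / n%:R * n%:R :> R by rewrite divfK// gt_eqF.
  rewrite powRM ?divr_ge0// ler_wpM2r ?powR_ge0// powR_le_sum//.
  by rewrite ler_pdivlMr// ler_pdivrMr// mul1r -natrM !ler_nat; lia.
have : ln (u n) <= ln (C * n%:R `^ (- g)).
  by rewrite ler_ln ?posrE ?mulr_gt0 ?powR_gt0.
rewrite lnM ?posrE ?powR_gt0// ln_powR.
move: lnC; rewrite ler_pdivrMr//; lra.
Unshelve. all: by end_near. Qed.

Theorem theorem1p2 (R : realType) (d : measure_display)
    (Omega : measurableType d) (P : probability Omega R)
    (tau : forall n : nat, Omega -> btree n)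
    (tau_uniform : forall n : nat, (0 < n)%N -> uniform_btree P (tau n))
    (alpha : R) :
  (exists! beta : R, Iint alpha beta = 0%E) /\
  (forall beta : R, Iint alpha beta = 0%E ->
    exists2 eps : nat -> R,
      eps n @[n --> \oo] --> (0 : R) &
      \forall n \near \oo,
        ('E_P[fun omega => leaf_power_sum alpha (tau n omega)] =
         (n%:R `^ (- beta + eps n))%:E)%E).
Proof.
have [b0 b0s b00] := Iint_root alpha.
split; first by exists b0; split => // b; exact: Iint_root_unique.
move=> b Ib; have bb : b = b0 by exact: Iint_root_unique Ib b00.
have bs : b < 2 * (alpha + 1) - 2^-1 by rewrite bb.
pose u n := mean_power_sum alpha n.
have u0 n : 0 < u n by exact: mean_power_sum_gt0.
(* The only choice that makes the identity exact once [ln n] is nonzero; what remains is that it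
   tends to 0. *)
exists (fun n => ln (u n) / ln n%:R + b).
  apply/cvgrPdist_le => e e0; have e20 : 0 < e / 2 by rewrite divr_gt0.
  have [K K0 hK] := @mean_power_sum_upper _ alpha b (b - e / 2) bs Ib ltac:(lra).
  have [L L0 hL] := @mean_power_sum_lower _ alpha b (b + e / 2) bs Ib ltac:(lra).
  have hi := near_ln_ratio_le e20 K0 u0 hK.
  (* The lower bound on [u] is an upper bound on its inverse, with the opposite exponent. *)
  have lo : \forall n \near \oo, ln (u n)^-1 / ln n%:R <= - - (b + e / 2) + e / 2.
    apply: (near_ln_ratio_le e20 L0) => [n|n]; first by rewrite invr_gt0.
    have := hL n; rewrite powRN opprK => h.
    by rewrite -[leLHS]mul1r ler_pdivrMr// mulrAC -ler_pdivrMr ?powR_gt0// div1r.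
  apply: filterS2 hi lo => n hi; rewrite lnV ?posrE// mulNr opprK => lo.
  by rewrite sub0r normrN ler_norml; apply/andP; split; lra.
near=> n.
(* At [n = 1] the logarithm vanishes and the quotient in [eps] would be the default 0. *)
have n1 : (1 < n)%N by near: n; exact: nbhs_infty_gt.
have n0 : (0 < n)%N by exact: ltnW.
have ln0 : 0 < ln (n%:R : R) by rewrite ln_gt0// ltr1n.
rewrite (expectation_uniform (fun t : btree n => leaf_power_sum alpha t) (tau_uniform n n0)).
rewrite -/(mean_power_sum alpha n) -/(u n); congr EFin.
rewrite addrCA addNr addr0 /powR gt_eqF ?ltr0n//.
by rewrite divfK ?gt_eqF// lnK ?posrE.
Unshelve. all: by end_near. Qed.
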